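(* Let $n,N\ge1$ and let $\{T_1,\ldots,T_h\}\subset\Lambda_n$ be a set of pairwise $\mathrm{GL}_n(\mathbf Z)$-inequivalent matrices. Then the weight $k$ Poincaré series $P_{T_1},\ldots,P_{T_h}$ on $\Gamma^{(n)}_0(N)$ are linearly independent provided $k\gg_n\max\{\mathrm{tr}\,T_j:1\le j\le h\}$; that is, provided $k\ge C_n\max_j\mathrm{tr}\,T_j$ for a suitable constant $C_n$ depending only on $n$.
   Context: $\Lambda_n$ is the set of positive definite half-integral symmetric $n\times n$ matrices (integral diagonal entries, off-diagonal entries in $\frac12\mathbf Z$). $T,T'$ are $\mathrm{GL}_n(\mathbf Z)$-equivalent if $T'=U^tTU$ for some $U\in\mathrm{GL}_n(\mathbf Z)$. $\Gamma=\Gamma_0^{(n)}(N)$ is the subgroup of $g=\begin{pmatrix}A&B\\C&D\end{pmatrix}$ in the Siegel modular group $\mathrm{Sp}_n(\mathbf Z)\subset\mathrm{GL}_{2n}(\mathbf Z)$ with $C\equiv0\bmod N$; it acts on the Siegel upper half space by $g(Z)=(AZ+B)(CZ+D)^{-1}$. With $\Gamma_\infty=\{\pm\begin{pmatrix}1_n&S\\0&1_n\end{pmatrix}:S\in\mathrm{Sym}_n(\mathbf Z)\}$, the Poincaré series of weight $k$ (an integer) is $P_T(Z)=\sum_{g\in\Gamma_\infty\backslash\Gamma}\det(CZ+D)^{-k}e(T\,g(Z))$, where $e(M)=\exp(2\pi i\,\mathrm{tr}\,M)$.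
   Formalization: The formal theorem adds that every U in GL_n(Z) with U^t T_j U = T_j satisfies (det U)^k = 1 (automatic for k even); otherwise the series P_{T_j} is identically zero or, when nk is odd, not well defined. *)

(* Defs.v *)
From HB Require Import structures.
From mathcomp Require Import all_boot all_order all_algebra generic_quotient.
From mathcomp Require Import all_classical all_reals all_analysis.
From mathcomp Require Import complex.

Set Implicit Arguments.
Unset Strict Implicit.
Unset Printing Implicit Defensive.

Import Order.TTheory GRing.Theory Num.Theory.

Local Open Scope ring_scope.
Local Open Scope quotient_scope.

Definition posdefmx (R : numDomainType) (n : nat) (M : 'M[R]_n) : Prop :=
  M^T = M /\ forall x : 'cV[R]_n, x != 0 -> 0 < (x^T *m M *m x) 0 0.

(* The set Lambda_n, realized inside the real matrices. *)
Definition Lambda (R : realType) (n : nat) (T : 'M[R]_n) : Prop :=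
  [/\ posdefmx T,
      forall i, T i i \is a Num.int
    & forall i j, i != j -> 2 * T i j \is a Num.int].

Definition intmx (R : pzRingType) (m n : nat) (A : 'M[int]_(m, n)) :
  'M[R]_(m, n) := map_mx intr A.

Definition GLequiv (R : realType) (n : nat) (T T' : 'M[R]_n) : Prop :=
  exists2 U : 'M[int]_n,
    U \in unitmx & T' = (intmx R U)^T *m T *m intmx R U.

(* In weight k one has P_T = (det U)^k P_(U^T T U) for U in GL_n(Z).  Hence, if
   some integral automorph U of T has (det U)^k = -1, then P_T is zero or (for
   U = -1, i.e. nk odd) its summand is not constant on the cosets of Gamma_oo.
   The condition below excludes exactly this; it is automatic for k even. *)
Definition automorph_compatible (R : realType) (n : nat) (k : int)
    (T : 'M[R]_n) : Prop :=
  forall U : 'M[int]_n, U \in unitmx ->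
    (intmx R U)^T *m T *m intmx R U = T -> (\det U) ^ k = 1.

Lemma automorph_compatible_even (R : realType) (n : nat) (k : int)
    (T : 'M[R]_n) : (2 %| k)%Z -> automorph_compatible k T.
Proof.
move=> /dvdzP[q ->] U; rewrite unitmxE => dU _.
have d2 : \det U * \det U = 1 by exact: (mulrV dU).
by rewrite mulrC -exprz_exp -[X in X ^ q]/(\det U * \det U) d2 exp1rz.
Qed.

Definition symplJ (n : nat) : 'M[int]_(n + n) := block_mx 0 1%:M (- 1%:M) 0.

Definition Gamma0 (n N : nat) : pred 'M[int]_(n + n) := fun g =>
  (g^T *m symplJ n *m g == symplJ n)
  && [forall i, forall j, (N%:Z %| dlsubmx g i j)%Z].

Definition Gamma_oo (n : nat) (g : 'M[int]_(n + n)) : Prop :=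
  exists (b : bool) (S : 'M[int]_n),
    S^T = S /\ g = (-1) ^+ b *: block_mx 1%:M S 0 1%:M.

Definition Gamma0_type (n N : nat) := {g : 'M[int]_(n + n) | Gamma0 N g}.

Definition Gamma_oo_rel (n N : nat) : rel (Gamma0_type n N) := fun g h =>
  `[< exists2 m, Gamma_oo m & val h = m *m val g >].

Lemma Gamma_oo_rel_refl (n N : nat) : reflexive (@Gamma_oo_rel n N).
Proof.
move=> g; apply/asboolP; exists 1%:M; last by rewrite mul1mx.
exists false, 0; rewrite trmx0; split=> //.
by rewrite expr0 scale1r -scalar_mx_block.
Qed.

Lemma Gamma_oo_rel_sym (n N : nat) : symmetric (@Gamma_oo_rel n N).
Proof.
suff H (g h : Gamma0_type n N) : Gamma_oo_rel g h -> Gamma_oo_rel h g.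
  by move=> g h; apply/idP/idP; exact: H.
move=> /asboolP[m [b [S [SS ->]]] E]; apply/asboolP.
exists ((-1) ^+ b *: block_mx 1%:M (- S) 0 1%:M).
  by exists b, (- S); rewrite linearN /= SS.
rewrite E mulmxA -scalemxAl -scalemxAr scalerA -expr2 sqrr_sign scale1r.
rewrite mulmx_block !(mul1mx, mulmx1, mul0mx, mulmx0, addr0, add0r) subrr.
by rewrite -scalar_mx_block mul1mx.
Qed.

Lemma Gamma_oo_rel_trans (n N : nat) : transitive (@Gamma_oo_rel n N).
Proof.
move=> h g l /asboolP[m [b [S [SS ->]]] E] /asboolP[m' [b' [S' [SS' ->]]] E'].
apply/asboolP; exists ((-1) ^+ (b (+) b') *: block_mx 1%:M (S + S') 0 1%:M).
  by exists (b (+) b'), (S + S'); rewrite linearD /= SS SS'.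
rewrite E' E mulmxA -scalemxAl -scalemxAr scalerA mulrC -signr_addb.
by rewrite mulmx_block !(mul1mx, mulmx1, mul0mx, mulmx0, addr0, add0r).
Qed.

Canonical Gamma_oo_equiv (n N : nat) : equiv_rel (Gamma0_type n N) :=
  EquivRel (@Gamma_oo_rel n N) (@Gamma_oo_rel_refl n N)
    (@Gamma_oo_rel_sym n N) (@Gamma_oo_rel_trans n N).

(* The coset space Gamma_oo \ Gamma_0(N). *)
Definition Gamma_coset (n N : nat) := {eq_quot (@Gamma_oo_equiv n N)}.
HB.instance Definition _ n N := Choice.on (Gamma_coset n N).

(* Sum of an absolutely convergent family; the value is meaningless for a family
   that is not absolutely summable. *)
Definition rsum (R : realType) (I : choiceType) (f : I -> R) : R :=
  fine (\esum_(i in [set: I]) ((EFin \o f)^\+)%E i)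
  - fine (\esum_(i in [set: I]) ((EFin \o f)^\-)%E i).

Definition csum (R : realType) (I : choiceType) (f : I -> R[i]) : R[i] :=
  Complex (rsum (fun i => complex.Re (f i))) (rsum (fun i => complex.Im (f i))).

Definition cexp (R : realType) (z : R[i]) : R[i] :=
  (expR (complex.Re z))%:C%C
  * Complex (cos (complex.Im z)) (sin (complex.Im z)).

Definition emx (R : realType) (n : nat) (M : 'M[R[i]]_n) : R[i] :=
  cexp (2 * (pi : R)%:C%C * 'i%C * \tr M).

Definition siegel_half_space (R : realType) (n : nat) (Z : 'M[R[i]]_n) : Prop :=
  Z^T = Z /\ posdefmx (map_mx (@complex.Im R) Z).

Definition siegel_denom (R : realType) (n : nat) (g : 'M[int]_(n + n))
    (Z : 'M[R[i]]_n) : 'M[R[i]]_n :=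
  intmx _ (dlsubmx g) *m Z + intmx _ (drsubmx g).

Definition siegel_act (R : realType) (n : nat) (g : 'M[int]_(n + n))
    (Z : 'M[R[i]]_n) : 'M[R[i]]_n :=
  (intmx _ (ulsubmx g) *m Z + intmx _ (ursubmx g))
  *m invmx (siegel_denom g Z).

Definition poincare_term (R : realType) (n : nat) (k : int) (T : 'M[R]_n)
    (Z : 'M[R[i]]_n) (g : 'M[int]_(n + n)) : R[i] :=
  (\det (siegel_denom g Z)) ^ (- k)
  * emx (map_mx (fun x : R => x%:C%C) T *m siegel_act g Z).

Definition poincare (R : realType) (n N : nat) (k : int) (T : 'M[R]_n)
    (Z : 'M[R[i]]_n) : R[i] :=
  csum (fun x : Gamma_coset n N => poincare_term k T Z (val (repr x))).

Definition lin_indep_on (K : pzRingType) (X : Type) (D : X -> Prop) (h : nat)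
    (f : 'I_h -> X -> K) : Prop :=
  forall c : 'I_h -> K,
    (forall x, D x -> \sum_(j < h) c j * f j x = 0) -> forall j, c j = 0.

(* Main.v *)
(** Evaluate at Z = X + 2i, and isolate the coefficient at T_j of a linear relation
    among the P_(T_i) by a finite average over X in a grid with spacing 1/M, M large,
    weighted by e(-T_j X): no integration is needed.  For g with lower blocks C, D put
    W = CZ + D and H = W W^*, a real positive definite matrix; then |det W|^2 = det H
    and Im g(Z) = 2 H^-1, so the term of g has absolute value
    (det H)^(-k/2) exp(-4 pi tr(T H^-1)).
    - Half of the exponential pays for absolute convergence: it beats every power of
      tr(H^-1), and tr H <= c_n det H tr(H^-1)^(n-1), while tr H dominates the squared
      entries of C and D.  The resulting bound is polynomial in tr T.
    - Choosing columns of C and D that form a basis shows det H >= 4^(rank C), so the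
      terms with C <> 0 carry a factor 2^-k.
    - For C = 0 the term is a multiple of e(U^T T U Z), U in GL_n(Z); the average kills
      it or makes it negligible unless U^T T_i U = T_j, which forces i = j.
    For k >= C_n max tr T_j the factor 2^-k beats exp(4 pi tr T_j) times the polynomial
    factors, and the matrix of coefficients of the P_(T_i) is diagonally dominant. *)
Require Import Defs.
From mathcomp Require Import all_boot all_order all_algebra generic_quotient.
From mathcomp Require Import all_classical all_reals all_analysis.
From mathcomp Require Import complex.
From mathcomp Require Import perm.
From mathcomp Require Import ring lra zify.
Import Order.TTheory GRing.Theory Num.Theory.
Local Open Scope ring_scope.

(** * Positive definite matrices and integral Gram determinants *)

Lemma gramE {R : pzRingType} m n (A : 'M[R]_(m, n)) :
  A^T *m A = \sum_i (row i A)^T *m row i A.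
Proof.
apply/matrixP => a b; rewrite mxE summxE; apply: eq_bigr => i _.
by rewrite !mxE big_ord1 !mxE.
Qed.

Lemma gram_posdef {R : realFieldType} n (G : 'M[R]_n) :
  G \in unitmx -> posdefmx (G^T *m G).
Proof.
move=> uG; split; first by rewrite trmx_mul trmxK.
move=> x x0; rewrite mulmxA -trmx_mul -mulmxA mxE.
have Gx0 : G *m x != 0.
  by apply: contraNneq x0 => Gx; rewrite -(mulKmx uG x) Gx mulmx0.
rewrite lt_neqAle; apply/andP; split; last first.
  by apply: sumr_ge0 => i _; rewrite mxE -expr2 sqr_ge0.
apply: contraNneq Gx0 => /esym/eqP; rewrite psumr_eq0 => [|i _]; last first.
  by rewrite mxE -expr2 sqr_ge0.
move=> /allP s0; apply/eqP/matrixP => i j; rewrite ord1 [RHS]mxE.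
have := s0 i (mem_index_enum _).
by rewrite [(_^T) _ _]mxE -expr2 sqrf_eq0 => /eqP.
Qed.

Lemma posdef_unit {R : numFieldType} n (A : 'M[R]_n) :
  posdefmx A -> A \in unitmx.
Proof.
move=> [_ pA]; rewrite unitmxE unitfE; apply/det0P => -[v v0 vA].
have /pA : v^T != 0 by rewrite trmx_eq0.
by rewrite trmxK vA mul0mx mxE ltxx.
Qed.

(** Matrix determinant lemma: the bordered matrix [B] is made block triangular once from the right
    and once from the left by unipotent factors. *)
Lemma det_add_rank1 {R : comUnitRingType} n (A : 'M[R]_n) (v : 'cV[R]_n) :
  A \in unitmx ->
  \det (A + v *m v^T) = \det A * (1 + (v^T *m invmx A *m v) 0 0).
Proof.
move=> uA; pose B := block_mx A (- v) v^T 1%:M.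
have E1 : B *m block_mx 1%:M 0 (- v^T) 1%:M
    = block_mx (A + v *m v^T) (- v) 0 1%:M.
  rewrite mulmx_block !(mulmx1, mulmx0, mul1mx, add0r) mulNmx mulmxN opprK.
  by rewrite subrr.
have E2 : B = block_mx 1%:M 0 (v^T *m invmx A) 1%:M *m
    block_mx A (- v) 0 (1%:M + v^T *m invmx A *m v).
  rewrite mulmx_block !(mulmx1, mulmx0, mul0mx, mul1mx, addr0).
  rewrite mulmxKV // mulmxN addrCA.
  by rewrite [- _ + _]addrC subrr addr0.
have := congr1 determinant E1; rewrite det_mulmx det_lblock !det1 !mulr1.
rewrite det_ublock det1 mulr1 => <-.
rewrite E2 det_mulmx det_lblock !det1 !mul1r det_ublock; congr (_ * _).
by rewrite det_mx11 !mxE.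
Qed.

(** Each rank one summand multiplies the determinant by [1 + v^T A^-1 v], and the inverse of a
    positive definite matrix takes nonnegative values. *)
Lemma det_add_gram_ge {R : realFieldType} n (A : 'M[R]_n) (s : seq 'cV[R]_n) :
  posdefmx A -> 0 < \det A ->
  \det A <= \det (A + \sum_(v <- s) v *m v^T).
Proof.
elim: s A => [|v s IHs] A pA dA; first by rewrite big_nil addr0.
have uA := posdef_unit _ _ pA; have [sA pA'] := pA.
have qv : 0 <= (v^T *m invmx A *m v) 0 0.
  have -> : v^T *m invmx A *m v = (invmx A *m v)^T *m A *m (invmx A *m v).
    by rewrite trmx_mul trmx_inv sA -!mulmxA mulKVmx.
  have [->|w0] := eqVneq (invmx A *m v) 0; last exact/ltW/pA'.
  by rewrite mulmx0 mxE.
have dle : \det A <= \det (A + v *m v^T).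
  by rewrite det_add_rank1 //; apply: ler_peMr; rewrite ?lerDl // ltW.
rewrite big_cons addrA; apply: (le_trans dle); apply: IHs; last first.
  exact: lt_le_trans dle.
split; first by rewrite linearD /= trmx_mul trmxK sA.
move=> x x0; rewrite mulmxDr mulmxDl mxE ltr_wpDr ?pA' //.
rewrite mulmxA -[_ *m v^T *m x]mulmxA.
have -> : v^T *m x = (x^T *m v)^T by rewrite trmx_mul trmxK.
by rewrite mxE big_ord1 [_^T _ _]mxE -expr2 sqr_ge0.
Qed.

Lemma gram_rowsub {R : realFieldType} m n p (A : 'M[R]_(m, n)) (f : 'I_p -> 'I_m) :
  injective f ->
  exists s : seq 'cV[R]_n,
    A^T *m A = (rowsub f A)^T *m rowsub f A + \sum_(v <- s) v *m v^T.
Proof.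
move=> f_inj; exists [seq (row i A)^T | i <- enum 'I_m & i \notin codom f].
rewrite big_map big_filter big_enum_cond /= gramE (bigID (mem (codom f))) /=.
congr (_ + _); last by apply: eq_bigr => i _; rewrite trmxK.
have uf : uniq (codom f) by rewrite map_inj_uniq ?enum_uniq.
rewrite -big_uniq //= /codom /image_mem big_map big_enum /= gramE.
by apply: eq_bigr => i _; rewrite row_rowsub.
Qed.

(** The casts come from selecting [p + q = n] rows: the stacked matrix is square only up to this
    equality. *)
Lemma det_castmx_mul {R : comPzRingType} m n (E : m = n) (A : 'M[R]_m)
    (B : 'M[R]_(m, n)) :
  \det (castmx (E, erefl n) (A *m B)) = \det A * \det (castmx (E, erefl n) B).
Proof. by case: n / E B => B; rewrite !castmx_id det_mulmx. Qed.

Lemma row_full_castmx {F : fieldType} m n (E : m = n) (A : 'M[F]_(m, n)) :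
  row_full (castmx (E, erefl n) A) = row_full A.
Proof. by case: n / E A => A; rewrite castmx_id. Qed.

Lemma gram_castmx {R : pzRingType} m n (E : m = n) (A : 'M[R]_(m, n)) :
  (castmx (E, erefl n) A)^T *m castmx (E, erefl n) A = A^T *m A.
Proof. by case: n / E A => A; rewrite castmx_id. Qed.

(** A one-term substitute for Cauchy-Binet: the Gram matrix of the selected rows is split off, and
    the outer products of the remaining rows can only increase the determinant. *)
Lemma det_gram_rowsub_ge {R : realFieldType} m1 m2 n p q (E : (p + q = n)%N)
    (A : 'M[R]_(m1, n)) (B : 'M[R]_(m2, n)) (f : 'I_p -> 'I_m1)
    (g : 'I_q -> 'I_m2)
    (G := castmx (E, erefl n) (col_mx (rowsub f A) (rowsub g B))) :
  injective f -> injective g ->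
  \det G != 0 -> \det G ^+ 2 <= \det (A^T *m A + B^T *m B).
Proof.
move=> f_inj g_inj G0.
have [s Es] := gram_rowsub _ _ _ A _ f_inj.
have [t Et] := gram_rowsub _ _ _ B _ g_inj.
have GG : G^T *m G = (rowsub f A)^T *m rowsub f A + (rowsub g B)^T *m rowsub g B.
  by rewrite gram_castmx tr_col_mx mul_row_col.
have -> : A^T *m A + B^T *m B = G^T *m G + \sum_(v <- s ++ t) v *m v^T.
  by rewrite Es Et GG big_cat /= addrACA.
have dG : \det G ^+ 2 = \det (G^T *m G) by rewrite det_mulmx det_tr.
rewrite dG; apply: det_add_gram_ge; last by rewrite -dG exprn_even_gt0.
by apply: gram_posdef; rewrite unitmxE unitfE.
Qed.

(** Basis completion: rows of [A] spanning its row space come first, then rows of [B] independent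
    modulo that space, read off from [B *m cokermx A]. *)
Lemma row_full_select {F : fieldType} m1 m2 n (A : 'M[F]_(m1, n)) (B : 'M[F]_(m2, n)) :
  row_full (col_mx A B) ->
  exists p q (f : 'I_p -> 'I_m1) (g : 'I_q -> 'I_m2),
  [/\ (p + q)%N = n, p = \rank A, injective f, injective g &
     (A <= rowsub f A)%MS /\ row_full (col_mx (rowsub f A) (rowsub g B))].
Proof.
move=> AB; pose K := B *m cokermx A.
exists (\rank A), (\rank K), (maxrankfun A), (maxrankfun K).
have /row_fullP[V] := AB; rewrite -[V]hsubmxK mul_row_col => V1.
split=> //; try exact: maxrankfun_inj.
- have -> : \rank K = \rank (cokermx A).
    apply/eqP; rewrite eqn_leq mxrankM_maxr; apply: mxrankS.
    rewrite -{1}[cokermx A]mul1mx -V1 mulmxDl -!mulmxA mulmx_coker mulmx0 add0r.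
    exact: submxMl.
  by rewrite mxrank_coker subnKC // rank_leq_col.
split; first by rewrite eq_maxrowsub.
set N := col_mx _ _.
have AN : (A <= N)%MS.
  by rewrite /N -addsmxE (submx_trans _ (addsmxSl _ _)) // eq_maxrowsub.
have /submxP[L KL] : (K <= rowsub (maxrankfun K) K)%MS by rewrite eq_maxrowsub.
(* Subtracting the combination [L] of selected rows of [B] leaves a matrix killed by [cokermx A],
   hence inside the row space of [A]. *)
have BN : (B <= N)%MS.
  rewrite -[B](subrK (L *m rowsub (maxrankfun K) B)) addmx_sub //.
    apply: (submx_trans _ AN); rewrite submxE mulmxBl -mulmxA.
    by rewrite mul_rowsub_mx -/K -KL subrr.
  apply: (submx_trans (submxMl _ _)).
  by rewrite /N -addsmxE addsmxSr.
have AB_N : (col_mx A B <= N)%MS by rewrite col_mx_sub AN.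
rewrite -sub1mx; apply: (submx_trans _ AB_N).
by rewrite sub1mx.
Qed.

Lemma det_int_sqr_ge1 {R : realFieldType} n (A : 'M[int]_n) :
  intmx R A \in unitmx -> 1 <= \det (intmx R A) ^+ 2.
Proof.
rewrite unitmxE unitfE det_map_mx intr_eq0 => dA.
by rewrite -rmorphXn /= -[1]/(1%:~R) ler_int -gtz0_ge1 exprn_even_gt0.
Qed.

(** A basis of the column space of [C] is completed by columns of [D]. The corresponding columns of
    [Q] and [P] have determinant [y ^ rank C] times that of a nonsingular integral matrix, whose
    square is at least 1. *)
Lemma det_siegel_gram_ge {R : realFieldType} n (C D : 'M[int]_n) (X : 'M[R]_n) (y : R)
    (P := intmx R C *m X + intmx R D) (Q := y *: intmx R C) :
  row_full (col_mx (intmx R C)^T (intmx R D)^T) -> 0 < y ->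
  y ^+ (2 * \rank (intmx R C)) <= \det (P *m P^T + Q *m Q^T).
Proof.
move=> fullCD y0.
have [p [q [f [g [E rp f_inj g_inj [CT fullN]]]]]] := row_full_select _ _ _ _ _ fullCD.
rewrite mxrank_tr in rp; rewrite -rp.
pose G0 := castmx (E, erefl n) (col_mx (rowsub f C^T) (rowsub g D^T)).
have G0E : intmx R G0 = castmx (E, erefl n)
    (col_mx (rowsub f (intmx R C)^T) (rowsub g (intmx R D)^T)).
  by rewrite /intmx map_castmx map_col_mx !map_mxsub -!map_trmx.
have uG0 : intmx R G0 \in unitmx.
  by rewrite -row_full_unit G0E row_full_castmx.
have /submxP[L CL] := CT.
pose G := castmx (E, erefl n) (col_mx (rowsub f Q^T) (rowsub g P^T)).
have dG : \det G = y ^+ p * \det (intmx R G0).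
  (* The [X]-part of [P] is a combination of columns of [C], hence of the selected ones, so it
     enters only the off-diagonal block. *)
  rewrite /G G0E; have -> : col_mx (rowsub f Q^T) (rowsub g P^T) =
     block_mx y%:M 0 (rowsub g (X^T *m L)) 1%:M *m
     col_mx (rowsub f (intmx R C)^T) (rowsub g (intmx R D)^T).
    rewrite mul_block_col mul0mx addr0 mul1mx mul_scalar_mx; congr col_mx.
      by apply/matrixP => i j; rewrite !mxE.
    rewrite mul_rowsub_mx -mulmxA -CL /P linearD /= trmx_mul.
    by apply/matrixP => i j; rewrite !mxE.
  by rewrite det_castmx_mul det_lblock det1 mulr1 det_scalar.
have G_neq0 : \det G != 0.
  rewrite dG; apply: mulf_neq0; last by rewrite -unitfE -unitmxE.
  by rewrite expf_neq0 // gt_eqF.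
have := det_gram_rowsub_ge _ _ _ _ _ E Q^T P^T _ _ f_inj g_inj G_neq0.
rewrite !trmxK [Q *m _ + _]addrC; apply: le_trans.
rewrite dG exprMn -exprM mulnC; apply: ler_peMr; last exact: det_int_sqr_ge1.
exact/exprn_ge0/ltW.
Qed.

(** * Trace and inverse bounds for positive semidefinite matrices *)

Lemma psd_entry_le {R : realFieldType} n (K : 'M[R]_n) i j :
  K^T = K -> (forall x : 'cV_n, 0 <= (x^T *m K *m x) 0 0) -> `|K i j| <= \tr K.
Proof.
move=> sK pK.
have Kij a b : (delta_mx (0 : 'I_1) a *m K *m delta_mx b (0 : 'I_1)) 0 0 = K a b.
  by rewrite -rowE -colE !mxE.
have d0 a : 0 <= K a a.
  by rewrite -Kij; have := pK (delta_mx a 0); rewrite trmx_delta.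
have Kba : K j i = K i j by rewrite -{1}sK mxE.
have [<-{j Kba}|ij] := eqVneq i j.
  rewrite ger0_norm // /mxtrace (bigD1 i) //= lerDl.
  by apply: sumr_ge0.
have tr2 : K i i + K j j <= \tr K.
  rewrite /mxtrace (bigD1 i) //= (bigD1 j) 1?eq_sym //= addrA lerDl.
  by apply: sumr_ge0.
have q (s : R) : 0 <= K i i + s * (K i j *+ 2) + s ^+ 2 * K j j.
  have := pK (delta_mx i 0 + s *: delta_mx j 0).
  have -> : (delta_mx i 0 + s *: delta_mx j 0 : 'cV[R]_n)^T =
      delta_mx 0 i + s *: delta_mx 0 j by rewrite linearD linearZ /= !trmx_delta.
  rewrite !mulmxDl !mulmxDr.
  rewrite -!scalemxAl -!scalemxAr.
  rewrite ![(_ + _ : 'M[R]_(_, _)) _ _]mxE ![(_ *: _ : 'M[R]_(_, _)) _ _]mxE !Kij Kba.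
  by congr (0 <= _); ring.
(* Testing on [e_i + e_j] and [e_i - e_j] gives [2 |K i j| <= K i i + K j j]. *)
have := q 1; have := q (-1); have := d0 i; have := d0 j.
by move=> *; rewrite ler_norml; apply/andP; split; lra.
Qed.

Lemma det_norm_le {R : realDomainType} n (A : 'M[R]_n) (c : R) :
  (forall i j, `|A i j| <= c) -> `|\det A| <= n`!%:R * c ^+ n.
Proof.
move=> Ac; rewrite /determinant; apply: (le_trans (ler_norm_sum _ _ _)).
have -> : n`!%:R * c ^+ n = \sum_(s : 'S_n) c ^+ n.
  by rewrite sumr_const card_Sn mulr_natl.
apply: ler_sum => s _; rewrite normrM normrX normrN1 expr1n mul1r normr_prod.
rewrite -[X in c ^+ X]card_ord -prodr_const; apply: ler_prod => i _.
by rewrite normr_ge0 Ac.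
Qed.

Lemma adj_norm_le {R : realDomainType} n (A : 'M[R]_n) (c : R) :
  (forall i j, `|A i j| <= c) ->
  forall i j, `|(\adj A) i j| <= n.-1`!%:R * c ^+ n.-1.
Proof.
move=> Ac i j; rewrite mxE normrM normrX normrN1 expr1n mul1r.
by apply: det_norm_le => a b; rewrite !mxE.
Qed.

(** Since [det H * det K = 1], [H] is [det H] times the adjugate of [K], whose entries are minors of
    size n - 1 in entries bounded by [tr K]. *)
Lemma trace_le_det_inv {R : realFieldType} n (H K : 'M[R]_n) :
  K^T = K -> (forall x : 'cV_n, 0 <= (x^T *m K *m x) 0 0) ->
  0 <= \det H -> H *m K = 1%:M ->
  \tr H <= n%:R * n.-1`!%:R * \det H * \tr K ^+ n.-1.
Proof.
move=> sK pK dH HK.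
have -> : \tr H = \det H * \tr (\adj K).
  rewrite -mxtraceZ; congr mxtrace.
  have dHK : \det H * \det K = 1 by rewrite -det_mulmx HK det1.
  rewrite -[\adj K]mul1mx -HK -mulmxA mul_mx_adj mul_mx_scalar scalerA dHK.
  by rewrite scale1r.
rewrite mulrAC [X in _ <= X]mulrC ler_wpM2l //.
have Kle i j : `|K i j| <= \tr K by exact: psd_entry_le.
rewrite -mulrA -[X in X%:R * _]card_ord mulr_natl -sumr_const.
by apply: ler_sum => i _; apply: le_trans (ler_norm _) (adj_norm_le _ _ _ Kle i i).
Qed.

(** Termwise this is [2 |a b| <= a^2 + b^2], summed over all pairs of indices. *)
Lemma quad_le {R : realFieldType} n (K : 'M[R]_n) (c : R) (x : 'cV_n) :
  (forall i j, `|K i j| <= c) ->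
  (x^T *m K *m x) 0 0 <= n%:R * c * (x^T *m x) 0 0.
Proof.
move=> Kc; have -> : (x^T *m K *m x) 0 0 = \sum_j \sum_i x i 0 * K i j * x j 0.
  by rewrite mxE; apply: eq_bigr => j _; rewrite mxE mulr_suml;
    apply: eq_bigr => i _; rewrite mxE.
have -> : n%:R * c * (x^T *m x) 0 0 =
    \sum_(j < n) \sum_(i < n) c * ((x i 0) ^+ 2 + (x j 0) ^+ 2) / 2.
  have S : (x^T *m x) 0 0 = \sum_i (x i 0) ^+ 2.
    by rewrite mxE; apply: eq_bigr => i _; rewrite mxE.
  have Sc : \sum_(j < n) (x j 0) ^+ 2 *+ n = n%:R * \sum_j (x j 0) ^+ 2.
    by rewrite sumrMnl mulr_natl.
  have S1 : \sum_(j < n) \sum_(i < n) (x i 0) ^+ 2 = n%:R * \sum_j (x j 0) ^+ 2.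
    by rewrite sumr_const card_ord mulr_natl.
  have S2 : \sum_(j < n) \sum_(i < n) (x j 0) ^+ 2 = n%:R * \sum_j (x j 0) ^+ 2.
    by rewrite -Sc; apply: eq_bigr => j _; rewrite sumr_const card_ord.
  rewrite S; transitivity (c / 2 * (\sum_(j < n) \sum_(i < n) (x i 0) ^+ 2
      + \sum_(j < n) \sum_(i < n) (x j 0) ^+ 2)); first by rewrite S1 S2; field.
  rewrite -big_split /= mulr_sumr; apply: eq_bigr => j _.
  rewrite -big_split /= mulr_sumr; apply: eq_bigr => i _; by field.
apply: ler_sum => j _; apply: ler_sum => i _.
have := Kc i j; rewrite ler_norml => /andP[K1 K2].
have : 0 <= (c - K i j) * (x i 0 + x j 0) ^+ 2.
  by rewrite mulr_ge0 ?sqr_ge0 ?subr_ge0.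
have : 0 <= (c + K i j) * (x i 0 - x j 0) ^+ 2.
  by rewrite mulr_ge0 ?sqr_ge0 // addrC -lerBlDr sub0r.
move: (x i 0) (x j 0) => a b; lra.
Qed.

(** A lower eigenvalue bound for [T] from an upper one for its inverse, obtained by expanding the
    positivity of [T] at [x - s T^-1 x] with [s = 1 / (n c)]. *)
Lemma quad_ge {R : realFieldType} n (T : 'M[R]_n) (c : R) (x : 'cV_n) :
  posdefmx T -> 0 < n%:R * c -> (forall i j, `|(invmx T) i j| <= c) ->
  (x^T *m x) 0 0 / (n%:R * c) <= (x^T *m T *m x) 0 0.
Proof.
move=> pT; have uT := posdef_unit _ _ pT; have [sT pT'] := pT.
set t := n%:R * c => t0 Tc; pose s := t^-1.
have sTi : (invmx T)^T = invmx T by rewrite trmx_inv sT.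
have pos (z : 'cV_n) : 0 <= (z^T *m T *m z) 0 0.
  have [->|z0] := eqVneq z 0; last exact/ltW/pT'.
  by rewrite mulmx0 mxE.
have := pos (x - s *: (invmx T *m x)).
have := quad_le _ _ _ x Tc; rewrite -/t.
set q := (x^T *m invmx T *m x) 0 0 => qle.
have sx : x^T *m (invmx T) *m T = x^T by rewrite mulmxKV.
have E : (x - s *: (invmx T *m x))^T *m T *m (x - s *: (invmx T *m x)) =
   x^T *m T *m x - s *: (x^T *m x) - s *: (x^T *m x)
    + (s * s) *: (x^T *m invmx T *m x).
  have -> : (x - s *: (invmx T *m x))^T = x^T - s *: (x^T *m invmx T).
    by rewrite linearB linearZ /= trmx_mul sTi.
  rewrite !mulmxBl !mulmxBr.
  rewrite -!scalemxAl -!scalemxAr sx -[x^T *m T *m (_ *m _)]mulmxA mulKVmx //.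
  by rewrite mulmxA scalerA opprB addrA addrAC.
rewrite E ![(_ + _ : 'M[R]_(_, _)) _ _]mxE ![(- _ : 'M[R]_(_, _)) _ _]mxE
  ![(_ *: _ : 'M[R]_(_, _)) _ _]mxE.
rewrite -/q -/s; move: (_ 0 0) ((x^T *m x) 0 0) qle => u v qle.
have s0 : 0 < s by rewrite invr_gt0.
have : s * s * q <= s * v.
  rewrite -mulrA ler_pM2l //; apply: (le_trans (ler_wpM2l (ltW s0) qle)).
  by rewrite /s mulrA mulVf ?mul1r // gt_eqF.
lra.
Qed.

Lemma tr_mul_gram {R : comPzRingType} n m (T : 'M[R]_n) (B : 'M[R]_(n, m)) :
  \tr (T *m (B *m B^T)) = \sum_j ((col j B)^T *m T *m col j B) 0 0.
Proof.
rewrite mulmxA mxtrace_mulC; apply: eq_bigr => j _; rewrite -[in RHS]mulmxA.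
have <- : col j (T *m B) = T *m col j B by rewrite !colE mulmxA.
by rewrite !mxE; apply: eq_bigr => i _; rewrite !mxE.
Qed.

(** Applied with [B B^T = H^-1], this lets [tr (T H^-1)] control [tr H^-1]. *)
Lemma trace_mul_ge {R : realFieldType} n m (T : 'M[R]_n) (c : R) (B : 'M[R]_(n, m)) :
  posdefmx T -> 0 < n%:R * c -> (forall i j, `|(invmx T) i j| <= c) ->
  \tr (B *m B^T) / (n%:R * c) <= \tr (T *m (B *m B^T)).
Proof.
move=> pT c0 Tc; rewrite -{1}[B *m B^T]mul1mx !tr_mul_gram mulr_suml.
by apply: ler_sum => j _; rewrite mulmx1; exact: quad_ge.
Qed.

(** * Absolutely convergent sums *)

(** [rsum] is meaningful only for absolutely summable families, so every sum below is controlled by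
    one weight [w] whose finite partial sums are at most [S]. *)
Definition bounded_sums {R : realType} {I : eqType} (w : I -> R) (S : R) : Prop :=
  (forall x, 0 <= w x) /\ forall s : seq I, uniq s -> \sum_(x <- s) w x <= S.

Definition dominated {R : realType} {I : Type} (w f : I -> R) : Prop :=
  exists K : R, forall x, `|f x| <= K * w x.

Definition nnsum {R : realType} {I : choiceType} (f : I -> R) : R :=
  fine (\esum_(i in [set: I]) (f i)%:E).

Lemma esum_bounded_sums {R : realType} {I : choiceType} (f : I -> R) (S : R) :
  bounded_sums f S -> (\esum_(i in [set: I]) (f i)%:E <= S%:E)%E.
Proof.
move=> [_ fS]; apply: ge_ereal_sup => /= _ [X [finX _]] <-.
by rewrite fsbig_finite //= sumEFin lee_fin; apply/fS/finmap.fset_uniq.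
Qed.

Lemma esum_fin_num {R : realType} {I : choiceType} (w f : I -> R) (S : R) :
  bounded_sums w S -> dominated w f -> (forall x, 0 <= f x) ->
  (\esum_(i in [set: I]) (f i)%:E)%E \is a fin_num.
Proof.
move=> [w0 wS] [K Kf] f0; rewrite ge0_fin_numE; last first.
  by apply: esum_ge0 => x _; rewrite lee_fin.
apply: (@le_lt_trans _ _ (`|K| * S)%:E); last exact: ltry.
apply: esum_bounded_sums; split=> // s us.
apply: (@le_trans _ _ (\sum_(x <- s) `|K| * w x)); last first.
  by rewrite -mulr_sumr ler_wpM2l // wS.
apply: ler_sum => x _; apply: (le_trans (ler_norm _)); apply: (le_trans (Kf x)).
by rewrite ler_wpM2r // ler_norm.
Qed.

Lemma nnsumD {R : realType} {I : choiceType} (w f g : I -> R) (S : R) :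
  bounded_sums w S -> dominated w f -> dominated w g ->
  (forall x, 0 <= f x) -> (forall x, 0 <= g x) ->
  nnsum (fun x => f x + g x) = nnsum f + nnsum g.
Proof.
move=> wS df dg f0 g0; rewrite /nnsum -fineD; last 2 first.
- exact: esum_fin_num wS df f0.
- exact: esum_fin_num wS dg g0.
rewrite -esumD; try by move=> x _; rewrite lee_fin.
by congr fine; apply: eq_esum => x _; rewrite EFinD.
Qed.

Lemma nnsumZ {R : realType} {I : choiceType} (a : R) (f : I -> R) :
  0 < a -> (forall x, 0 <= f x) ->
  nnsum (fun x => a * f x) = a * nnsum f.
Proof.
move=> a0 f0; rewrite /nnsum /esum.
have -> : [set (\sum_(x \in A) (a * f x)%:E)%E | A in fsets setT]%classic =
   [set (a%:E * x)%E | x in [set (\sum_(x \in A) (f x)%:E)%E | A in fsets setT]]%classic.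
  rewrite image_comp; apply: eq_imagel => A /= [finA _].
  rewrite ge0_mule_fsumr; last by move=> x; rewrite lee_fin.
  by apply: eq_fsbigr => x _; rewrite EFinM.
rewrite ereal_sup_pZl //; case: (ereal_sup _) => [r||] //=.
(* [fine] sends an infinite supremum to 0 on both sides. *)
- by rewrite gt0_muley ?lte_fin //= mulr0.
- by rewrite gt0_muleNy ?lte_fin //= mulr0.
Qed.

Lemma nnsum_le {R : realType} {I : choiceType} (f : I -> R) (S : R) :
  bounded_sums f S -> nnsum f <= S.
Proof.
move=> fS; have f0 := fS.1.
have df : dominated f f by exists 1 => x; rewrite mul1r ger0_norm.
rewrite -lee_fin fineK; first exact: esum_bounded_sums.
exact: esum_fin_num fS df f0.
Qed.

Lemma nnsum_ge1 {R : realType} {I : choiceType} (w f : I -> R) (S : R) x :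
  bounded_sums w S -> dominated w f -> (forall x, 0 <= f x) -> f x <= nnsum f.
Proof.
move=> wS df f0; rewrite -lee_fin fineK; last exact: esum_fin_num wS df f0.
by apply: esum_ge; exists [set x]%classic; [split|rewrite fsbig_set1].
Qed.

(** Any dominated decomposition into nonnegative parts computes [rsum]: one has [f^+ + h = g + f^-],
    and sums of nonnegative families are additive. Linearity follows by choosing convenient
    decompositions. *)
Lemma rsumB {R : realType} {I : choiceType} (w f g h : I -> R) (S : R) :
  bounded_sums w S -> dominated w g -> dominated w h ->
  (forall x, 0 <= g x) -> (forall x, 0 <= h x) ->
  (forall x, f x = g x - h x) -> rsum f = nnsum g - nnsum h.
Proof.
move=> wS dg dh g0 h0 fE.
pose p x := Num.max (f x) 0; pose q x := Num.max (- f x) 0.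
have -> : rsum f = nnsum p - nnsum q.
  rewrite /rsum /nnsum !unlock; congr (fine _ - fine _);
  by apply: eq_esum => x _; rewrite EFin_max.
have p0 x : 0 <= p x by rewrite le_max lexx orbT.
have q0 x : 0 <= q x by rewrite le_max lexx orbT.
have df : dominated w f.
  have [K Kg] := dg; have [L Lh] := dh; exists (K + L) => x.
  by rewrite fE mulrDl (le_trans (ler_normB _ _)) // lerD.
have dp : dominated w p.
  have [K Kf] := df; exists K => x; apply: le_trans (Kf x).
  by rewrite ger0_norm // ge_max ler_norm normr_ge0.
have dq : dominated w q.
  have [K Kf] := df; exists K => x; apply: le_trans (Kf x).
  by rewrite ger0_norm // ge_max -normrN ler_norm normr_ge0.
apply/eqP; rewrite subr_eq addrAC eq_sym subr_eq; apply/eqP.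
rewrite -(nnsumD w g q S) // -(nnsumD w p h S) //; congr nnsum.
apply/funext => x; rewrite /p /q; have := fE x.
by case: (leP (f x) 0); case: (leP (- f x) 0) => *; lra.
Qed.

Lemma rsum_split {R : realType} {I : choiceType} (w f : I -> R) (S : R) :
  bounded_sums w S -> dominated w f ->
  exists g h : I -> R, [/\ dominated w g, dominated w h,
    (forall x, 0 <= g x), (forall x, 0 <= h x) & forall x, f x = g x - h x].
Proof.
move=> [w0 _] [K Kf].
exists (fun x => Num.max (f x) 0), (fun x => Num.max (- f x) 0).
split; try by move=> x; rewrite le_max lexx orbT.
- exists K => x; apply: le_trans (Kf x).
  by rewrite ger0_norm ?ge_max ?ler_norm ?normr_ge0 // le_max lexx orbT.
- exists K => x; apply: le_trans (Kf x).
  by rewrite ger0_norm ?ge_max -1?normrN ?ler_norm ?normr_ge0 // le_max lexx orbT.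
- by move=> x; case: (leP (f x) 0); case: (leP (- f x) 0) => *; lra.
Qed.

Lemma dominatedD {R : realType} {I : Type} (w f g : I -> R) :
  dominated w f -> dominated w g -> dominated w (fun x => f x + g x).
Proof.
move=> [K Kf] [L Lg]; exists (K + L) => x.
by rewrite mulrDl (le_trans (ler_normD _ _)) // lerD.
Qed.

Lemma dominatedZ {R : realType} {I : Type} (w f : I -> R) (a : R) :
  dominated w f -> dominated w (fun x => a * f x).
Proof.
by move=> [K Kf]; exists (`|a| * K) => x; rewrite normrM -mulrA ler_wpM2l.
Qed.

Lemma rsumD {R : realType} {I : choiceType} (w f g : I -> R) (S : R) :
  bounded_sums w S -> dominated w f -> dominated w g ->
  rsum (fun x => f x + g x) = rsum f + rsum g.
Proof.
move=> wS df dg.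
have [f1 [f2 [df1 df2 f1p f2p fE]]] := rsum_split _ _ _ wS df.
have [g1 [g2 [dg1 dg2 g1p g2p gE]]] := rsum_split _ _ _ wS dg.
rewrite (rsumB w f f1 f2 S) // (rsumB w g g1 g2 S) //.
rewrite (rsumB w _ (fun x => f1 x + g1 x) (fun x => f2 x + g2 x) S) //;
  [|exact: dominatedD|exact: dominatedD|by move=> x; rewrite addr_ge0..|].
  by rewrite !(nnsumD w _ _ S) //; ring.
by move=> x; rewrite fE gE; ring.
Qed.

Lemma rsumZ {R : realType} {I : choiceType} (w f : I -> R) (S a : R) :
  bounded_sums w S -> dominated w f -> rsum (fun x => a * f x) = a * rsum f.
Proof.
move=> wS df.
have [g [h [dg dh g0 h0 fE]]] := rsum_split _ _ _ wS df.
have pos b : 0 < b -> rsum (fun x => b * f x) = b * rsum f.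
  move=> b0; rewrite (rsumB w f g h S) //.
  rewrite (rsumB w _ (fun x => b * g x) (fun x => b * h x) S) //;
    [|exact: dominatedZ|exact: dominatedZ
     |by move=> x; apply: mulr_ge0; rewrite // ltW..|].
    by rewrite !nnsumZ // mulrBr.
  by move=> x; rewrite fE mulrBr.
have zero (z : I -> R) : (forall x, z x = 0) -> rsum z = 0.
  move=> z0; rewrite (rsumB w z g g S) ?subrr // => x.
  by rewrite z0 subrr.
have [a0|a0|->] := ltgtP a 0; last 2 first.
- exact: pos.
- by rewrite zero ?mul0r // => x; rewrite mul0r.
(* For negative [a], the families [a f] and [- a f] cancel, and [- a] is covered by the positive
   case. *)
have : rsum (fun x => a * f x + - a * f x) = 0.
  by apply: zero => x /=; ring.
rewrite (rsumD w _ _ S) //; try exact: dominatedZ.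
by rewrite (pos (- a)) ?oppr_gt0 // mulNr => /eqP; rewrite subr_eq0 => /eqP.
Qed.

(** * Complex-valued families *)

Notation normc := ComplexField.Normc.normc.

Definition cdominated {R : realType} {I : Type} (w : I -> R) (f : I -> R[i]) : Prop :=
  exists K : R, forall x, normc (f x) <= K * w x.

Lemma normc_Re {R : realType} (z : R[i]) : `|complex.Re z| <= normc z.
Proof.
case: z => a b /=; rewrite -sqrtr_sqr ler_sqrt ?addr_ge0 ?sqr_ge0 //.
by rewrite lerDl sqr_ge0.
Qed.

Lemma normc_Im {R : realType} (z : R[i]) : `|complex.Im z| <= normc z.
Proof.
case: z => a b /=; rewrite -sqrtr_sqr ler_sqrt ?addr_ge0 ?sqr_ge0 //.
by rewrite lerDr sqr_ge0.
Qed.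

Lemma normcD_le {R : realType} (y z : R[i]) : normc (y + z) <= normc y + normc z.
Proof. by rewrite -lecR rmorphD /=; exact: (@ler_normD _ R[i]). Qed.

Lemma cdominated_Re {R : realType} {I : Type} (w : I -> R) (f : I -> R[i]) :
  cdominated w f -> dominated w (fun x => complex.Re (f x)).
Proof. by move=> [K Kf]; exists K => x; apply: le_trans (normc_Re _) (Kf x). Qed.

Lemma cdominated_Im {R : realType} {I : Type} (w : I -> R) (f : I -> R[i]) :
  cdominated w f -> dominated w (fun x => complex.Im (f x)).
Proof. by move=> [K Kf]; exists K => x; apply: le_trans (normc_Im _) (Kf x). Qed.

Lemma cdominatedD {R : realType} {I : Type} (w : I -> R) (f g : I -> R[i]) :
  cdominated w f -> cdominated w g -> cdominated w (fun x => f x + g x).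
Proof.
move=> [K Kf] [L Lg]; exists (K + L) => x.
by rewrite mulrDl (le_trans (normcD_le _ _)) // lerD.
Qed.

Lemma cdominatedZ {R : realType} {I : Type} (w : I -> R) (f : I -> R[i]) (a : R[i]) :
  cdominated w f -> cdominated w (fun x => a * f x).
Proof.
move=> [K Kf]; exists (normc a * K) => x.
rewrite ComplexField.Normc.normcM -mulrA ler_wpM2l //.
by case: (a) => u v /=; rewrite sqrtr_ge0.
Qed.

Lemma csumD {R : realType} {I : choiceType} (w : I -> R) (S : R) (f g : I -> R[i]) :
  bounded_sums w S -> cdominated w f -> cdominated w g ->
  csum (fun x => f x + g x) = csum f + csum g.
Proof.
move=> wS df dg; rewrite /csum.
have -> : (fun x => complex.Re (f x + g x)) =
    (fun x => complex.Re (f x) + complex.Re (g x)).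
  by apply/funext => x; case: (f x) (g x) => [? ?] [? ?].
have -> : (fun x => complex.Im (f x + g x)) =
    (fun x => complex.Im (f x) + complex.Im (g x)).
  by apply/funext => x; case: (f x) (g x) => [? ?] [? ?].
rewrite (rsumD _ _ _ _ wS (cdominated_Re _ _ df) (cdominated_Re _ _ dg)).
by rewrite (rsumD _ _ _ _ wS (cdominated_Im _ _ df) (cdominated_Im _ _ dg)).
Qed.

Lemma csumZ {R : realType} {I : choiceType} (w : I -> R) (S : R) (f : I -> R[i])
    (a : R[i]) :
  bounded_sums w S -> cdominated w f -> csum (fun x => a * f x) = a * csum f.
Proof.
move=> wS df; rewrite /csum; case: a => u v.
have dRe := cdominated_Re _ _ df; have dIm := cdominated_Im _ _ df.
have -> : (fun x => complex.Re (Complex u v * f x)) =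
    (fun x => u * complex.Re (f x) + - v * complex.Im (f x)).
  by apply/funext => x; case: (f x) => a b /=; rewrite mulNr.
have -> : (fun x => complex.Im (Complex u v * f x)) =
    (fun x => u * complex.Im (f x) + v * complex.Re (f x)).
  by apply/funext => x; case: (f x) => a b /=.
rewrite !(rsumD w _ _ S wS); try exact: dominatedZ.
rewrite !(rsumZ w _ S _ wS) //.
by apply/eqP; rewrite eq_complex /= mulNr !eqxx.
Qed.

(** Domination is carried along with the formula, since additivity of [csum] requires it at each
    step. Later [J] consists of pairs of a form and a grid point. *)
Lemma csum_lincomb {R : realType} {I : choiceType} {J : eqType} (w : I -> R) (S : R)
    (r : seq J) (a : J -> R[i]) (f : J -> I -> R[i]) :
  bounded_sums w S -> (forall j, cdominated w (f j)) ->
  cdominated w (fun x => \sum_(j <- r) a j * f j x) /\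
  csum (fun x => \sum_(j <- r) a j * f j x) = \sum_(j <- r) a j * csum (f j).
Proof.
move=> wS df; elim: r => [|j r [IHd IHs]].
  have z0 : cdominated w (fun=> 0).
    by exists 0 => x; rewrite mul0r ComplexField.Normc.normc0.
  have -> : (fun x => \sum_(j <- [::]) a j * f j x) = (fun=> 0).
    by apply/funext => x; rewrite big_nil.
  split=> //; rewrite big_nil -[RHS](mul0r (csum (fun x : I => 0))).
  by rewrite -(csumZ w S) //; congr csum; apply/funext => x; rewrite mul0r.
have E : (fun x => \sum_(j <- j :: r) a j * f j x) =
    (fun x => a j * f j x + \sum_(j <- r) a j * f j x).
  by apply/funext => x; rewrite big_cons.
rewrite E big_cons; split; first exact/cdominatedD/IHd/cdominatedZ.
by rewrite (csumD w S) // ?IHs ?(csumZ w S) //; exact: cdominatedZ.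
Qed.

(** Write [f] as [(f + e w) - e w]. The first family is nonnegative, so its sum is at least its
    value at [x0], hence at least [mu]; the second sums to at most [e S]. *)
Lemma rsum_gt0 {R : realType} {I : choiceType} (w f : I -> R) (S mu e : R) (x0 : I) :
  bounded_sums w S -> dominated w f -> 0 <= e -> e * S < mu ->
  (forall x, (if x == x0 then mu else 0) - e * w x <= f x) -> 0 < rsum f.
Proof.
move=> wS df e0 eS fge.
have w0 := wS.1.
have dew : dominated w (fun x => e * w x).
  by exists e => x; rewrite ger0_norm // mulr_ge0.
have p0 x : 0 <= f x + e * w x.
  have := fge x; rewrite lerBlDr; apply: le_trans; case: ifP => // _.
  apply/ltW/(le_lt_trans _ eS)/mulr_ge0 => //.
  by have := wS.2 [::] isT; rewrite big_nil.
rewrite (rsumB w f (fun x => f x + e * w x) (fun x => e * w x) S) //.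
- have := nnsum_ge1 w (fun x => f x + e * w x) S x0 wS (dominatedD _ _ _ df dew) p0.
  have := fge x0; rewrite eqxx.
  have : nnsum (fun x => e * w x) <= e * S.
    apply: nnsum_le; split=> [x|s us]; first exact: mulr_ge0.
    by rewrite -mulr_sumr ler_wpM2l // wS.2.
  lra.
- exact: dominatedD.
- by move=> x; rewrite mulr_ge0.
- by move=> x; rewrite addrK.
Qed.

(** * Summable weights on integer vectors *)

Definition int_weight {R : realType} (z : int) : R := (1 + z%:~R ^+ 2)^-1.

Lemma int_weight_gt0 {R : realType} (z : int) : 0 < int_weight z :> R.
Proof. by rewrite invr_gt0 ltr_wpDr // sqr_ge0. Qed.

(** Telescoping against [2 / (u (u + 1)) = 2 / u - 2 / (u + 1)]; equality holds at [m = 0]. *)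
Lemma sum_int_weight_nat {R : realType} m :
  \sum_(a < m.+1) int_weight a <= 3 - 2 / m.+1%:R :> R.
Proof.
elim: m => [|m IHm].
  by rewrite big_ord1 /int_weight expr0n addr0 invr1; lra.
rewrite big_ord_recr /=; apply: (le_trans (lerD IHm (lexx _))).
rewrite /int_weight -pmulrn.
have m0 : 0 < m.+1%:R :> R by rewrite ltr0n.
rewrite -[m.+2%:R]natr1; move: (m.+1%:R : R) m0 => u u0.
have u1 : 0 < u + 1 by lra.
have h : (1 + u ^+ 2)^-1 <= 2 / (u * (u + 1)).
  rewrite ler_pdivlMr ?mulr_gt0 // mulrC ler_pdivrMr; last by rewrite ltr_wpDr // sqr_ge0.
  have := sqr_ge0 (u - 1); nra.
have -> : 3 - 2 / (u + 1) = 3 - 2 / u + 2 / (u * (u + 1)) :> R.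
  by field; rewrite !gt_eqF.
by rewrite lerD2l.
Qed.

Lemma sum_int_weight {R : realType} m :
  \sum_(a < m + m.+1) int_weight (a%:Z - m%:Z) <= 6 :> R.
Proof.
have nat3 k : \sum_(a < k) int_weight a <= 3 :> R.
  case: k => [|k]; first by rewrite big_ord0.
  apply: (le_trans (sum_int_weight_nat k)).
  by rewrite gerBl divr_ge0.
rewrite big_split_ord /=.
have -> : 6 = 3 + 3 :> R by lra.
apply: lerD; last first.
  apply: le_trans (nat3 m.+1); apply: ler_sum => a _.
  by rewrite /= PoszD addrAC subrr add0r.
(* Reversed, the negative half has weights at [-(a + 1)], each at most the weight at [a]. *)
rewrite (reindex_inj rev_ord_inj) /=; apply: le_trans (nat3 m); apply: ler_sum => a _.
rewrite /int_weight lef_pV2 ?posrE ?ltr_wpDr ?sqr_ge0 // lerD2l.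
have -> : (m - a.+1)%N%:Z - m%:Z = - (a.+1%:Z).
  by rewrite -subzn ?ltn_ord // addrAC subrr add0r.
rewrite rmorphN sqrrN lerXn2r ?nnegrE ?ler0z //.
by rewrite ler_int lez_nat.
Qed.

(** Finitely many points lie in a box, where the sum of products factors into one-variable sums,
    each at most 6. Injectivity of [phi] sends distinct points to distinct lattice points of the
    box. *)
Lemma bounded_sums_int_weight {R : realType} {I : eqType} {J : finType}
    (phi : I -> J -> int) :
  (forall x y, phi x =1 phi y -> x = y) ->
  bounded_sums (fun x => \prod_j int_weight (phi x j) : R) (6 ^+ #|J|).
Proof.
move=> phi_inj; split=> [x|s us].
  by apply: prodr_ge0 => j _; apply/ltW/int_weight_gt0.
pose B := (\max_(x <- s) \max_j `|phi x j|)%N.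
have phiB x j : x \in s -> (`|phi x j| <= B)%N.
  move=> xs; apply: (@leq_trans (\max_j `|phi x j|)); first exact: leq_bigmax.
  by rewrite /B (big_rem x) //= leq_maxl.
(* Coordinates are shifted by [B] into [0, ..., 2 B]; for points of [s] the default of [insubd] is
   never reached. *)
pose psi x : {ffun J -> 'I_(B + B.+1)} :=
  [ffun j => insubd (Ordinal (ltn_addl B (ltn0Sn B))) (absz (phi x j + B%:Z))].
have psiE x j : x \in s -> (psi x j)%:Z - B%:Z = phi x j.
  move=> /phiB - /(_ j) pB; rewrite ffunE val_insubd ifT; last by lia.
  lia.
have -> : \sum_(x <- s) \prod_j int_weight (phi x j) =
    \sum_(g <- map psi s) \prod_j (int_weight ((g j)%:Z - B%:Z) : R).
  rewrite big_map; apply: eq_big_seq => x xs; apply: eq_bigr => j _.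
  by rewrite psiE.
have upsi : uniq (map psi s).
  rewrite map_inj_in_uniq // => x y xs ys Exy; apply: phi_inj => j.
  by rewrite -!psiE // Exy.
rewrite big_uniq //=.
apply: (@le_trans _ _ (\sum_(g : {ffun J -> 'I_(B + B.+1)})
    \prod_j (int_weight ((g j)%:Z - B%:Z) : R))).
  rewrite [leRHS](bigID (mem (map psi s))) /= lerDl.
  by apply: sumr_ge0 => g _; apply: prodr_ge0 => j _; apply/ltW/int_weight_gt0.
rewrite -(bigA_distr_bigA (fun (j : J) (a : 'I_(B + B.+1)) => int_weight (a%:Z - B%:Z) : R)).
rewrite -prodr_const; apply: ler_prod => j _; rewrite sum_int_weight andbT.
by apply: sumr_ge0 => a _; apply/ltW/int_weight_gt0.
Qed.

(** * The exponential and finite character sums *)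

Definition e2pi {R : realType} (z : R[i]) : R[i] := cexp (2 * (pi : R)%:C%C * 'i%C * z).

Lemma cexpD {R : realType} (y z : R[i]) : cexp (y + z) = cexp y * cexp z.
Proof.
case: y z => a b [c d]; rewrite /cexp /= expRD cosD sinD.
by apply/eqP; rewrite eq_complex /=; apply/andP; split; apply/eqP; ring.
Qed.

Lemma e2piD {R : realType} (y z : R[i]) : e2pi (y + z) = e2pi y * e2pi z.
Proof. by rewrite /e2pi mulrDr cexpD. Qed.

Lemma e2piE {R : realType} (a b : R) :
  e2pi (Complex a b) = (expR (- (2 * pi * b)))%:C%C *
    Complex (cos (2 * pi * a)) (sin (2 * pi * a)).
Proof.
rewrite /e2pi /cexp.
have -> : 2 * (pi : R)%:C%C * 'i%C * Complex a b =
    Complex (- (2 * pi * b)) (2 * pi * a).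
  apply/eqP; rewrite eq_complex /=; apply/andP; split; apply/eqP; ring.
by [].
Qed.

Lemma e2pi0 {R : realType} : e2pi 0 = 1 :> R[i].
Proof.
rewrite e2piE !mulr0 oppr0 expR0 cos0 sin0; apply/eqP.
by rewrite eq_complex /= !mul1r !mul0r subr0 addr0 !eqxx.
Qed.

Lemma e2pi_sum {R : realType} (J : Type) (r : seq J) (P : pred J) (z : J -> R[i]) :
  e2pi (\sum_(j <- r | P j) z j) = \prod_(j <- r | P j) e2pi (z j).
Proof. by apply: (big_morph (@e2pi R)); [exact: e2piD|exact: e2pi0]. Qed.

Lemma e2piMn {R : realType} (z : R[i]) m : e2pi (z *+ m) = e2pi z ^+ m.
Proof.
elim: m => [|m IHm]; first by rewrite mulr0n e2pi0 expr0.
by rewrite mulrS e2piD IHm exprS.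
Qed.

Lemma e2pi1 {R : realType} : e2pi 1 = 1 :> R[i].
Proof.
rewrite e2piE mulr0 oppr0 expR0 mulr1 mulr_natl cos2pi.
have -> : sin (pi *+ 2) = 0 :> R by rewrite mulr2n sinD sinpi !mul0r mulr0 addr0.
by apply/eqP; rewrite eq_complex /= !mul1r !mul0r subr0 addr0 !eqxx.
Qed.

Lemma e2piN {R : realType} (z : R[i]) : e2pi z * e2pi (- z) = 1.
Proof. by rewrite -e2piD subrr e2pi0. Qed.

Lemma e2pi_int {R : realType} (m : int) : e2pi m%:~R = 1 :> R[i].
Proof.
have nat1 k : e2pi k%:R = 1 :> R[i] by rewrite e2piMn e2pi1 expr1n.
case: m => m; first exact: nat1.
by rewrite NegzE mulrNz -[RHS](e2piN (m.+1%:R)) nat1 mul1r.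
Qed.

Lemma normc_e2pi {R : realType} (z : R[i]) :
  normc (e2pi z) = expR (- (2 * pi * complex.Im z)).
Proof.
case: z => a b; rewrite e2piE ComplexField.Normc.normcM /= cos2Dsin2 sqrtr1.
by rewrite expr0n /= addr0 sqrtr_sqr mulr1 ger0_norm // expR_ge0.
Qed.

(** If the value were 1, its real part [cos (2 pi a)] would be 1, against [sin (pi a) > 0]. *)
Lemma e2pi_neq1 {R : realType} (a : R) : 0 < a < 1 -> e2pi a%:C%C != 1.
Proof.
move=> /andP[a0 a1]; apply/negP => /eqP/(congr1 (@complex.Re R)).
rewrite e2piE mulr0 oppr0 expR0 /= mul1r mul0r subr0.
have -> : 2 * pi * a = (pi * a) *+ 2 by ring.
rewrite cos_mulr2n.
have s0 : 0 < sin (pi * a).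
  have p0 := pi_gt0 R; apply: sin_gt0_pi.
  by apply/andP; split; nra.
by have := cos2Dsin2 (pi * a); nra.
Qed.

(** A geometric sum at the [M]-th root of unity [z = e(d / M)], which differs from 1 because
    [0 < |d| < M]. *)
Lemma char_sum0 {R : realType} (M : nat) (d : int) :
  d != 0 -> (`|d| < M)%N ->
  \sum_(a < M) e2pi ((d%:~R * a%:R / M%:R : R)%:C%C) = 0.
Proof.
move=> d0 dM; have M0 : (0 < M)%N by exact: leq_ltn_trans dM.
have M0' : M%:R != 0 :> R by rewrite pnatr_eq0 -lt0n.
pose z : R[i] := e2pi ((d%:~R / M%:R : R)%:C%C).
have zE (a : nat) : e2pi ((d%:~R * a%:R / M%:R : R)%:C%C) = z ^+ a.
  by rewrite -e2piMn -rmorphMn /=; congr (e2pi _%:C%C); rewrite -mulr_natr; field.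
under eq_bigr do rewrite zE.
have zM : z ^+ M = 1.
  rewrite -zE mulfK // -[RHS](e2pi_int d); congr e2pi.
  exact: (rmorph_int (real_complex R)).
have z1 : z != 1.
  case: d d0 dM @z zE zM => m m0 mM z zE zM.
    apply/e2pi_neq1/andP; split; first by rewrite divr_gt0 // ltr0n // lt0n.
    by rewrite ltr_pdivrMr ?ltr0n // mul1r ltr_nat.
  apply/negP => /eqP z1.
  have : e2pi ((m.+1%:R / M%:R : R)%:C%C) = 1.
    rewrite -[LHS]mul1r -{1}z1 -e2piD -rmorphD /= NegzE mulrNz mulNr addNr.
    exact: e2pi0.
  apply/eqP/e2pi_neq1/andP; split; first by rewrite divr_gt0 // ltr0n.
  by rewrite ltr_pdivrMr ?ltr0n // mul1r ltr_nat.
apply/eqP; have := subrX1 z M; rewrite zM subrr => /esym/eqP.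
by rewrite mulf_eq0 subr_eq0 (negPf z1).
Qed.

(** The sum over the grid factors over the coordinates, and the factor at [j0] vanishes. *)
Lemma char_sum_prod {R : realType} (J : finType) (M : nat) (d : J -> int) j0 :
  d j0 != 0 -> (forall j, `|d j| < M)%N ->
  \sum_(f : {ffun J -> 'I_M})
    e2pi ((\sum_j (d j)%:~R * (f j)%:R / M%:R : R)%:C%C) = 0.
Proof.
move=> d0 dM.
under eq_bigr do rewrite rmorph_sum e2pi_sum.
rewrite -(bigA_distr_bigA (fun j (a : 'I_M) => e2pi (((d j)%:~R * a%:R / M%:R : R)%:C%C))).
by rewrite (bigD1 j0) //= char_sum0 // mul0r.
Qed.

(** * Symplectic matrices acting on X + iy *)

(** From [J^2 = -1], the inverse of [g] is [- J g^T J]. *)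
Lemma symplectic_inv n (g : 'M[int]_(n + n)) :
  g^T *m symplJ n *m g = symplJ n ->
  g *m block_mx (drsubmx g)^T (- (ursubmx g)^T) (- (dlsubmx g)^T) (ulsubmx g)^T = 1%:M.
Proof.
move=> gJ; apply: mulmx1C.
have JJ : symplJ n *m symplJ n = - 1%:M.
  rewrite /symplJ mulmx_block !(mul0mx, mulmx0, mul1mx, mulmx1, add0r, addr0).
  by rewrite (scalar_mx_block n n 1) opp_block_mx !oppr0.
suff -> : block_mx (drsubmx g)^T (- (ursubmx g)^T) (- (dlsubmx g)^T) (ulsubmx g)^T
    = - (symplJ n *m g^T *m symplJ n).
  by rewrite mulNmx -!mulmxA [g^T *m _]mulmxA gJ JJ opprK.
rewrite -{5}[g]submxK tr_block_mx /symplJ !mulmx_block.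
rewrite !(mul0mx, mulmx0, mul1mx, mulmx1, add0r, addr0, mulNmx, mulmxN).
by rewrite opp_block_mx !opprK.
Qed.

Lemma symplectic_blocks n (g : 'M[int]_(n + n)) (A := ulsubmx g) (B := ursubmx g)
    (C := dlsubmx g) (D := drsubmx g) :
  g^T *m symplJ n *m g = symplJ n ->
  [/\ A *m D^T - B *m C^T = 1%:M, C *m D^T = D *m C^T,
      A^T *m C = C^T *m A, B^T *m D = D^T *m B
    & A^T *m D - C^T *m B = 1%:M /\ D^T *m A - B^T *m C = 1%:M].
Proof.
move=> gJ; have gi := symplectic_inv _ _ gJ; have ig := mulmx1C gi.
have gE : g = block_mx A B C D by rewrite submxK.
have gi' : block_mx A B C D *m block_mx D^T (- B^T) (- C^T) A^T = 1%:M.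
  by rewrite -gE.
have ig' : block_mx D^T (- B^T) (- C^T) A^T *m block_mx A B C D = 1%:M.
  by rewrite -gE.
move: gi' ig'; rewrite !mulmx_block.
rewrite !(mulmxN, mulNmx) (scalar_mx_block n n 1).
move=> /eq_block_mx[h1 _ h2 _] /eq_block_mx[h3 h4 h5 h6]; split=> //.
- by apply/eqP; rewrite -subr_eq0 h2.
- by apply/eqP; rewrite -subr_eq0 addrC h5.
- by apply/esym/eqP; rewrite -subr_eq0 h4.
- by split=> //; rewrite addrC.
Qed.

(** The relation [A D^T - B C^T = 1] exhibits a left inverse. *)
Lemma symplectic_row_full {R : realFieldType} n (g : 'M[int]_(n + n)) :
  g^T *m symplJ n *m g = symplJ n ->
  row_full (col_mx (intmx R (dlsubmx g))^T (intmx R (drsubmx g))^T).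
Proof.
move=> /symplectic_blocks[E _ _ _ _]; apply/row_fullP.
exists (row_mx (- intmx R (ursubmx g)) (intmx R (ulsubmx g))).
rewrite mul_row_col mulNmx /intmx !map_trmx -!map_mxM addrC -map_mxB E.
exact: map_mx1.
Qed.

Notation toC := (map_mx (real_complex _)).

Lemma intmx_toC {R : realType} m n (A : 'M[int]_(m, n)) :
  intmx R[i] A = toC (intmx R A).
Proof. by apply/matrixP => i j; rewrite !mxE rmorph_int. Qed.

Lemma intmxT {R : pzRingType} {m n} (A : 'M[int]_(m, n)) : (intmx R A)^T = intmx R A^T.
Proof. by rewrite /intmx map_trmx. Qed.

Lemma intmxM {R : pzRingType} m n p (A : 'M[int]_(m, n)) (B : 'M[int]_(n, p)) :
  intmx R (A *m B) = intmx R A *m intmx R B.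
Proof. by rewrite /intmx map_mxM. Qed.

Definition adjC {R : realType} {m n} (A : 'M[R[i]]_(m, n)) : 'M[R[i]]_(n, m) :=
  (map_mx (@conjc R) A)^T.

Lemma adjCM {R : realType} m n p (A : 'M[R[i]]_(m, n)) (B : 'M[R[i]]_(n, p)) :
  adjC (A *m B) = adjC B *m adjC A.
Proof. by rewrite /adjC map_mxM trmx_mul. Qed.

Lemma adjCD {R : realType} m n (A B : 'M[R[i]]_(m, n)) :
  adjC (A + B) = adjC A + adjC B.
Proof. by rewrite /adjC map_mxD linearD. Qed.

Lemma adjC_toC {R : realType} m n (A : 'M[R]_(m, n)) : adjC (toC A) = toC A^T.
Proof. by apply/matrixP => i j; rewrite !mxE conjc_real. Qed.

Lemma adjC_intmx {R : realType} m n (A : 'M[int]_(m, n)) :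
  adjC (intmx R[i] A) = intmx R[i] A^T.
Proof. by rewrite !intmx_toC adjC_toC intmxT. Qed.

Lemma adjC_unit {R : realType} n (A : 'M[R[i]]_n) : (adjC A \in unitmx) = (A \in unitmx).
Proof. by rewrite /adjC unitmx_tr map_unitmx. Qed.

Lemma adjC_inv {R : realType} n (A : 'M[R[i]]_n) : adjC (invmx A) = invmx (adjC A).
Proof. by rewrite /adjC map_invmx trmx_inv. Qed.

Lemma det_adjC {R : realType} n (A : 'M[R[i]]_n) : \det (adjC A) = conjc (\det A).
Proof. by rewrite /adjC det_tr det_map_mx. Qed.

Definition point_over {R : realType} {n} (X : 'M[R]_n) (y : R) : 'M[R[i]]_n :=
  toC X + (Complex 0 y)%:M.

Lemma adjC_point {R : realType} n (X : 'M[R]_n) (y : R) : X^T = X ->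
  adjC (point_over X y) = point_over X (- y).
Proof.
move=> sX; rewrite adjCD adjC_toC sX; congr (_ + _).
by rewrite /adjC map_scalar_mx tr_scalar_mx.
Qed.

Lemma point_siegel {R : realType} n (X : 'M[R]_n) (y : R) : X^T = X -> 0 < y ->
  siegel_half_space (point_over X y).
Proof.
move=> sX y0; split.
  by rewrite linearD /= tr_scalar_mx map_trmx sX.
have -> : map_mx (@complex.Im R) (point_over X y) = y%:M.
  apply/matrixP => i j; rewrite !mxE; case: (i == j) => /=; first by rewrite add0r.
  by rewrite addr0.
split; first by rewrite tr_scalar_mx.
move=> x x0; rewrite mul_mx_scalar -scalemxAl mxE mulr_gt0 //.
have := gram_posdef _ (1%:M : 'M[R]_n) (unitmx1 _ _); rewrite trmx1 mulmx1.
by move=> [_ /(_ x x0)]; rewrite mulmx1.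
Qed.

(** Invariance of the alternating form. Primed letters stand for transposes and [u] for the adjoint
    of [z]; keeping them independent makes this a plain identity over a commutative ring. *)
Lemma symplectic_form {S : comPzRingType} n (a b c d a' b' c' d' u z : 'M[S]_n) :
  a' *m c = c' *m a -> b' *m d = d' *m b ->
  a' *m d - c' *m b = 1%:M -> d' *m a - b' *m c = 1%:M ->
  (u *m a' + b') *m (c *m z + d) - (u *m c' + d') *m (a *m z + b) = u - z.
Proof.
move=> E1 E2 /eqP; rewrite subr_eq => /eqP E3 /eqP; rewrite subr_eq => /eqP E4.
have e1 := congr1 (fun M => u *m M *m z) E1.
have e3 := congr1 (mulmx u) E3; have e4 := congr1 (mulmx^~ z) E4.
move: e1 e3 e4; rewrite /= !mulmxDr !mulmxDl mulmx1 mul1mx !mulmxA.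
rewrite ?mulmxDr ?mulmxDl ?mulmxA => -> -> ->; rewrite E2.
by apply/matrixP => i j; rewrite ![(_ + _ : 'M[S]_n) _ _]mxE ![(- _ : 'M[S]_n) _ _]mxE
  ![(_ + _ : 'M[S]_n) _ _]mxE; ring.
Qed.

Lemma tr_mul_adjC {R : realType} n (T : 'M[R]_n) (M : 'M[R[i]]_n) : T^T = T ->
  \tr (toC T *m adjC M) = conjc (\tr (toC T *m M)).
Proof.
move=> sT; rewrite -mxtrace_tr trmx_mul trmxK map_trmx sT mxtrace_mulC.
rewrite -trace_map_mx map_mxM; congr (\tr (_ *m _)).
by apply/matrixP => i j; rewrite !mxE [RHS]conjc_real.
Qed.

Lemma sub_invmx_mul {S : comUnitRingType} n (M M' V V' : 'M[S]_n) :
  M \in unitmx -> M' \in unitmx ->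
  invmx M' *m V' - V *m invmx M = invmx M' *m (V' *m M - M' *m V) *m invmx M.
Proof.
move=> uM uM'; rewrite mulmxBr mulmxBl !mulmxA mulVmx // mul1mx.
by rewrite -[_ *m M *m _]mulmxA mulmxV // mulmx1.
Qed.

(** For [W = C Z + D = P + i Q] at [Z = X + i y], this is [W] times its adjoint when [g] is
    symplectic and [X] symmetric: the symmetry of [C D^T] cancels the imaginary part. *)
Definition siegel_gram {R : realType} {n} (g : 'M[int]_(n + n)) (X : 'M[R]_n) (y : R)
    (P := intmx R (dlsubmx g) *m X + intmx R (drsubmx g))
    (Q := y *: intmx R (dlsubmx g)) : 'M[R]_n :=
  P *m P^T + Q *m Q^T.

Section SiegelPoint.

Context {R : realType} (n : nat) (g : 'M[int]_(n + n)) (X : 'M[R]_n) (y : R).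
Hypothesis gJ : g^T *m symplJ n *m g = symplJ n.
Hypothesis sX : X^T = X.

Let Z := point_over X y.
Let C := dlsubmx g.
Let D := drsubmx g.
Let P := intmx R C *m X + intmx R D.
Let Q := y *: intmx R C.
Let H := siegel_gram g X y.
Let W := siegel_denom g Z.

Let WE : W = toC P + 'i%C *: toC Q.
Proof.
rewrite /W /siegel_denom !intmx_toC mulmxDr -map_mxM addrAC -map_mxD; congr (_ + _).
rewrite mul_mx_scalar; apply/matrixP => i j; rewrite !mxE.
by apply/eqP; rewrite eq_complex /=; apply/andP; split; apply/eqP; ring.
Qed.

Lemma siegel_denom_gram : W *m adjC W = toC H.
Proof.
have QP : Q *m P^T = P *m Q^T.
  rewrite /P /Q linearD linearZ /= trmx_mul sX mulmxDr mulmxDl -!scalemxAl -!scalemxAr.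
  rewrite !mulmxA !intmxT -!intmxM; have [_ -> _ _ _] := symplectic_blocks _ _ gJ.
  by rewrite ?scalerDr.
rewrite WE adjCD; have -> : adjC ('i%C *: toC Q) = - 'i%C *: toC Q^T.
  apply/matrixP => i j; rewrite !mxE.
  by apply/eqP; rewrite eq_complex /=; apply/andP; split; apply/eqP; ring.
rewrite adjC_toC !mulmxDl !mulmxDr -!scalemxAl -!scalemxAr -!map_mxM QP.
rewrite !scaleNr scalerN scalerA -expr2 sqr_i scaleN1r opprK.
by rewrite addrA subrK -map_mxD.
Qed.

Lemma normc_sqr_conj (z : R[i]) : z * conjc z = (normc z ^+ 2)%:C%C.
Proof.
by case: z => a b; apply/eqP; rewrite eq_complex /= sqr_sqrtr ?addr_ge0 ?sqr_ge0 //;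
  apply/andP; split; apply/eqP; ring.
Qed.

Lemma normc_det_denom : normc (\det W) ^+ 2 = \det H.
Proof.
apply: complexI; rewrite -normc_sqr_conj -det_adjC -det_mulmx siegel_denom_gram.
by rewrite det_map_mx.
Qed.

Hypothesis y_gt0 : 0 < y.

Lemma normc_det_denom_ge : y ^+ \rank (intmx R C) <= normc (\det W).
Proof.
have nc0 : 0 <= normc (\det W) by case: (\det W) => a b /=; exact: sqrtr_ge0.
have y0 : 0 <= y ^+ \rank (intmx R C) by exact/exprn_ge0/ltW.
rewrite -ler_sqr ?nnegrE // normc_det_denom -exprM mulnC.
exact: det_siegel_gram_ge n C D X y (symplectic_row_full _ _ gJ) y_gt0.
Qed.

Lemma siegel_denom_unit : W \in unitmx.
Proof.
rewrite unitmxE unitfE; apply/eqP => W0.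
have := normc_det_denom_ge; rewrite W0 ComplexField.Normc.normc0.
by rewrite leNgt exprn_gt0.
Qed.

Lemma gram_unit : H \in unitmx.
Proof.
rewrite unitmxE unitfE -normc_det_denom expf_neq0 // gt_eqF //.
exact: lt_le_trans (exprn_gt0 _ y_gt0) normc_det_denom_ge.
Qed.

(** Write g(Z) as [V W^-1]. Over the common denominators [adjC W] and [W], the numerator of the
    difference is [adjC Z - Z = -2 i y] by invariance of the form, and [W *m adjC W] is [H]. *)
Lemma siegel_act_adj :
  adjC (siegel_act g Z) - siegel_act g Z = - (Complex 0 (2 * y)) *: toC (invmx H).
Proof.
have uW := siegel_denom_unit; have uWa : adjC W \in unitmx by rewrite adjC_unit.
have [_ _ E1 E2 [E3 E4]] := symplectic_blocks _ _ gJ.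
pose V : 'M[R[i]]_n := intmx _ (ulsubmx g) *m Z + intmx _ (ursubmx g).
have VW : adjC V *m W - adjC W *m V = adjC Z - Z.
  rewrite /V /W /siegel_denom !(adjCD _ _ (_ *m _)) !adjCM !adjC_intmx; apply: symplectic_form.
  - by rewrite -!intmxM E1.
  - by rewrite -!intmxM E2.
  - by rewrite -!intmxM /intmx -map_mxB E3 map_mx1.
  - by rewrite -!intmxM /intmx -map_mxB E4 map_mx1.
have -> : toC (invmx H) = invmx (adjC W) *m invmx W.
  have uWW : W *m adjC W \in unitmx by rewrite unitmx_mul uW.
  apply: (can_inj (mulKmx uWW)).
  rewrite map_invmx -siegel_denom_gram mulmxV // -mulmxA mulKVmx //.
  by rewrite mulmxV.
rewrite /siegel_act -/W -/V adjCM adjC_inv.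
rewrite (sub_invmx_mul _ W (adjC W)) //.
rewrite VW.
rewrite adjC_point //.
have -> : point_over X (- y) - Z = (- (Complex 0 (2 * y)))%:M.
  rewrite /Z /point_over opprD addrACA subrr add0r -raddfB; congr _%:M.
  by apply/eqP; rewrite eq_complex /= ; apply/andP; split; apply/eqP; ring.
by rewrite mul_mx_scalar -scalemxAl.
Qed.

(** For real symmetric [T], the trace against the adjoint of g(Z) is the conjugate of the trace
    against g(Z), so [siegel_act_adj] yields the imaginary part. *)
Lemma Im_tr_act (T : 'M[R]_n) : T^T = T ->
  complex.Im (\tr (toC T *m siegel_act g Z)) = y * \tr (T *m invmx H).
Proof.
move=> sT; have := congr1 (fun M => \tr (toC T *m M)) siegel_act_adj.
rewrite /= mulmxBr -scalemxAr mxtraceZ raddfB /= -map_mxM.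
rewrite (tr_mul_adjC _ T) // trace_map_mx; case: (\tr (toC T *m siegel_act g Z)) => a b.
move=> /(congr1 (@complex.Im R)) /=.
lra.
Qed.

End SiegelPoint.

(** * Bounds for a single coset *)

Lemma exprn_le_expR {R : realType} (x : R) p : 0 <= x -> x ^+ p <= p`!%:R * expR x.
Proof.
move=> x0; case: p => [|p]; first by rewrite expr0 mul1r -expR0 ler_expR.
rewrite mulrC -ler_pdivrMr ?ltr0n ?fact_gt0 //.
by apply: le_trans (expR_ge1Dxn p x0); rewrite lerDr.
Qed.

Lemma siegel_gram_sym {R : realType} n (g : 'M[int]_(n + n)) (X : 'M[R]_n) (y : R) :
  (siegel_gram g X y)^T = siegel_gram g X y.
Proof. by rewrite /siegel_gram linearD /= !trmx_mul !trmxK. Qed.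

(** With [H = L L^T], the matrix [B = H^-1 L] works. This shows the inverse to be positive
    semidefinite and puts it in the form required by [trace_mul_ge]. *)
Lemma invmx_siegel_gram {R : realType} n (g : 'M[int]_(n + n)) (X : 'M[R]_n) (y : R) :
  siegel_gram g X y \in unitmx ->
  exists B : 'M[R]_(n, n + n), invmx (siegel_gram g X y) = B *m B^T.
Proof.
move=> uH; pose L := row_mx (intmx R (dlsubmx g) *m X + intmx R (drsubmx g))
  (y *: intmx R (dlsubmx g)).
have HL : siegel_gram g X y = L *m L^T by rewrite tr_row_mx mul_row_col.
exists (invmx (siegel_gram g X y) *m L).
rewrite trmx_mul trmx_inv siegel_gram_sym mulmxA -[_ *m L *m _]mulmxA -HL.
by rewrite mulVmx // mul1mx.
Qed.

Lemma gram_psd {R : realFieldType} n m (B : 'M[R]_(n, m)) (x : 'cV_n) :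
  0 <= (x^T *m (B *m B^T) *m x) 0 0.
Proof.
have -> : x^T *m (B *m B^T) *m x = (B^T *m x)^T *m (B^T *m x).
  by rewrite trmx_mul trmxK !mulmxA.
by rewrite mxE; apply: sumr_ge0 => i _; rewrite mxE -expr2 sqr_ge0.
Qed.

Lemma sqr_le_tr_gram {R : realFieldType} n m (P Q : 'M[R]_(n, m)) i j :
  P i j ^+ 2 + Q i j ^+ 2 <= \tr (P *m P^T + Q *m Q^T).
Proof.
have E (A : 'M[R]_(n, m)) : A i j ^+ 2 <= \tr (A *m A^T).
  have sq a b : 0 <= A a b * A^T b a by rewrite mxE -expr2 sqr_ge0.
  rewrite /mxtrace (bigD1 i) //= mxE (bigD1 j) //= mxE -expr2 -addrA lerDl.
  apply: addr_ge0; first exact: sumr_ge0.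
  by apply: sumr_ge0 => l _; rewrite mxE sumr_ge0.
by rewrite raddfD /= lerD.
Qed.

Lemma symplectic_neq0 n (g : 'M[int]_(n + n)) : (0 < n)%N ->
  g^T *m symplJ n *m g = symplJ n -> exists i j, dsubmx g i j != 0.
Proof.
move=> n0 gJ; apply: contrapT => nE.
have Z' i j : dsubmx g i j = 0.
  by apply/eqP; apply: contra_notT nE => ij; exists i, j.
have [E _ _ _ _] := symplectic_blocks _ _ gJ.
have C0 : dlsubmx g = 0.
  by apply/matrixP => i j; rewrite mxE [RHS]mxE -[RHS](Z' i (lshift n j)) !mxE.
have D0 : drsubmx g = 0.
  by apply/matrixP => i j; rewrite mxE [RHS]mxE -[RHS](Z' i (rshift n j)) !mxE.
move: E; rewrite C0 D0 trmx0 !mulmx0 subr0.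
move=> /matrixP/(_ (Ordinal n0) (Ordinal n0)); rewrite !mxE eqxx.
by move=> /eqP; rewrite eq_sym oner_eq0.
Qed.

Lemma int_sqr_ge1 {R : realDomainType} (z : int) : z != 0 -> 1 <= z%:~R ^+ 2 :> R.
Proof.
by move=> z0; rewrite -rmorphXn /= -[1]/(1%:~R) ler_int -gtz0_ge1 exprn_even_gt0.
Qed.

(** The trace dominates the squared entries of [2 C] and of [P = C X + D]; those of [D = P - C X]
    follow from the bound on [X]. The summand 1 is absorbed by [1 <= tr H]. *)
Lemma tr_siegel_gram_ge {R : realType} n (g : 'M[int]_(n + n)) (X : 'M[R]_n) i j :
  (0 < n)%N -> g^T *m symplJ n *m g = symplJ n -> (forall i j, `|X i j| <= 2) ->
  1 + (dsubmx g i j)%:~R ^+ 2 <= (1 + (1 + n%:R) ^+ 2) * \tr (siegel_gram g X 2).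
Proof.
move=> n0 gJ X2; set s := \tr _.
have PQ a b := sqr_le_tr_gram _ _ (intmx R (dlsubmx g) *m X + intmx R (drsubmx g))
  (2 *: intmx R (dlsubmx g)) a b.
have C2 a b : 4 * (dlsubmx g a b)%:~R ^+ 2 <= s.
  apply: le_trans (PQ a b); rewrite [in X in _ <= _ + X]mxE [in X in _ <= _ + X]mxE.
  by rewrite exprMn -natrX ler_wpDl ?sqr_ge0.
have P2 a b : (intmx R (dlsubmx g) *m X + intmx R (drsubmx g)) a b ^+ 2 <= s.
  by apply: le_trans (PQ a b); rewrite lerDl sqr_ge0.
(* An integral [C <> 0] has an entry of absolute value at least 1; if [C = 0], then [P = D] has
   one. *)
have s1 : 1 <= s.
  have [C0|/eqP C0] := eqVneq (dlsubmx g) 0; last first.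
    have [a [b ab]] : exists a b, dlsubmx g a b != 0.
      apply: contra_notP C0 => H; apply/matrixP => a b; rewrite [RHS]mxE.
      by apply/eqP; apply: contra_notT H => H; exists a, b.
    by have := int_sqr_ge1 (R := R) _ ab; have := C2 a b; lra.
  have [a [b ab]] := symplectic_neq0 _ _ n0 gJ.
  have := P2 a; move: ab; case: (split_ordP b) => c ->.
    have -> : dsubmx g a (lshift n c) = dlsubmx g a c by rewrite !mxE.
    by rewrite C0 mxE eqxx.
  have -> : dsubmx g a (rshift n c) = drsubmx g a c by rewrite !mxE.
  move=> ac /(_ c); rewrite C0 [intmx R 0]map_mx0 mul0mx add0r mxE.
  by apply: le_trans; exact: int_sqr_ge1.
have s0 : 0 <= s by apply: le_trans s1.
pose r := Num.sqrt s; have r0 : 0 <= r by exact: sqrtr_ge0.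
have rs : r ^+ 2 = s by rewrite sqr_sqrtr.
have Cr a b : 2 * `|(dlsubmx g a b)%:~R : R| <= r.
  rewrite -ler_sqr ?nnegrE ?mulr_ge0 // exprMn real_normK ?num_real // rs.
  by rewrite -natrX C2.
have Pr a b : `|(intmx R (dlsubmx g) *m X + intmx R (drsubmx g)) a b| <= r.
  by rewrite -ler_sqr ?nnegrE // real_normK ?num_real // rs P2.
case: (split_ordP j) => c ->.
  have -> : dsubmx g i (lshift n c) = dlsubmx g i c by rewrite !mxE.
  have := C2 i c; have : 0 <= (1 + n%:R) ^+ 2 * s by rewrite mulr_ge0 ?sqr_ge0.
  have : 1 <= (1 + n%:R) ^+ 2 :> R by rewrite exprn_ege1 // lerDl.
  nra.
have -> : dsubmx g i (rshift n c) = drsubmx g i c by rewrite !mxE.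
have Dr : `|(drsubmx g i c)%:~R : R| <= (1 + n%:R) * r.
  have -> : (drsubmx g i c)%:~R =
      (intmx R (dlsubmx g) *m X + intmx R (drsubmx g)) i c - (intmx R (dlsubmx g) *m X) i c.
    by rewrite [(_ + intmx R (drsubmx g)) i c]mxE addrAC subrr add0r [RHS]mxE.
  rewrite mulrDl mul1r; apply: (le_trans (ler_normB _ _)); apply: lerD => //.
  rewrite mxE; apply: (le_trans (ler_norm_sum _ _ _)).
  rewrite mulr_natl -[X in _ *+ X]card_ord -sumr_const; apply: ler_sum => l _.
  rewrite mxE normrM; apply: le_trans (Cr i l); rewrite [leRHS]mulrC.
  by rewrite ler_wpM2l.
have : (drsubmx g i c)%:~R ^+ 2 <= (1 + n%:R) ^+ 2 * s.
  by rewrite -rs -exprMn -[leLHS]real_normK ?num_real // lerXn2r ?nnegrE ?mulr_ge0 ?addr_ge0.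
rewrite mulrDl mul1r; lra.
Qed.

(** The summable majorant on cosets: the bottom block row [(C, D)] determines the coset, and each of
    its entries receives a summable factor. *)
Definition coset_weight {R : realType} {n} (g : 'M[int]_(n + n)) : R :=
  \prod_(p : 'I_n * 'I_(n + n)) int_weight (dsubmx g p.1 p.2).

Lemma coset_weight_ge0 {R : realType} n (g : 'M[int]_(n + n)) :
  0 <= coset_weight g :> R.
Proof. by apply: prodr_ge0 => p _; apply/ltW/int_weight_gt0. Qed.

Lemma coset_weight_ge {R : realType} n (g : 'M[int]_(n + n)) (X : 'M[R]_n)
    (m := #|{: 'I_n * 'I_(n + n)}|) :
  (0 < n)%N -> g^T *m symplJ n *m g = symplJ n -> (forall i j, `|X i j| <= 2) ->
  1 <= coset_weight g *
    ((1 + (1 + n%:R) ^+ 2) * \tr (siegel_gram g X 2)) ^+ m.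
Proof.
move=> n0 gJ X2; rewrite -prodr_const -big_split /=.
apply: (@le_trans _ _ (\prod_(p : 'I_n * 'I_(n + n)) (1 : R))).
  by rewrite big1_eq.
apply: ler_prod => p _; rewrite ler01 /int_weight mulrC ler_pdivlMr ?mul1r.
  exact: tr_siegel_gram_ge.
by rewrite ltr_wpDr // sqr_ge0.
Qed.

(* The factor in [exp_trace_le], where [kappa] bounds the entries of T^-1. *)
Definition gauss_const (R : realType) (n : nat) (kappa : R)
    (m := #|{: 'I_n * 'I_(n + n)}|) (p := (n.-1 * m)%N) : R :=
  ((1 + (1 + n%:R) ^+ 2) * (n%:R * n.-1`!%:R)) ^+ m * ((n%:R * kappa) ^+ p * p`!%:R).

(** Put [d = |det W|] and [u = tr (T H^-1)]. Up to constants, the weight is at least a power of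
    [1 / tr H], and [tr H] is at most [d^2] times the power n - 1 of [tr H^-1]. Moreover
    [tr H^-1 <= n kappa u], and [exp(2 pi u)] beats the resulting power of [u]. *)
Lemma exp_trace_le {R : realType} n (g : 'M[int]_(n + n)) (X T : 'M[R]_n) (kappa : R)
    (m := #|{: 'I_n * 'I_(n + n)}|) :
  (0 < n)%N -> g^T *m symplJ n *m g = symplJ n ->
  X^T = X -> (forall i j, `|X i j| <= 2) ->
  posdefmx T -> 0 < kappa -> (forall i j, `|(invmx T) i j| <= kappa) ->
  expR (- (2 * pi * \tr (T *m invmx (siegel_gram g X 2)))) <=
  gauss_const R n kappa * coset_weight g *
    normc (\det (siegel_denom g (point_over X 2))) ^+ (2 * m).
Proof.
move=> n0 gJ sX X2 pT k0 Tk; set H := siegel_gram g X 2; set K := invmx H.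
set d := normc _; set u := \tr (T *m K).
have nk0 : 0 < n%:R * kappa by rewrite mulr_gt0 // ltr0n.
have uH : H \in unitmx by apply: gram_unit.
have [B KB] := invmx_siegel_gram _ _ _ _ uH; rewrite -/H -/K in KB.
have pK (x : 'cV_n) : 0 <= (x^T *m K *m x) 0 0 by rewrite KB; exact: gram_psd.
have sK : K^T = K by rewrite KB trmx_mul trmxK.
have dH : d ^+ 2 = \det H by exact: normc_det_denom.
have tr0 : 0 <= \tr K.
  by have := psd_entry_le _ _ (Ordinal n0) (Ordinal n0) sK pK; exact: le_trans.
have trH : \tr H <= n%:R * n.-1`!%:R * d ^+ 2 * \tr K ^+ n.-1.
  by rewrite dH; apply: trace_le_det_inv => //; rewrite -?dH ?sqr_ge0 // mulmxV.
have Ku : \tr K <= n%:R * kappa * u.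
  rewrite mulrC -ler_pdivrMr //; rewrite /u KB; exact: trace_mul_ge.
have u0 : 0 <= u by rewrite -(pmulr_rge0 _ nk0) (le_trans tr0).
have w0 : 0 <= coset_weight g :> R by exact: coset_weight_ge0.
have := coset_weight_ge n g X n0 gJ X2; rewrite -/m -/H => w1.
have eu : u ^+ (n.-1 * m) <= (n.-1 * m)`!%:R * expR (2 * pi * u).
  apply: (le_trans (exprn_le_expR u _ u0)); rewrite ler_wpM2l // ler_expR.
  by rewrite -[leLHS]mul1r ler_wpM2r //; have := pi_ge2 R; lra.
set b : R := 1 + (1 + n%:R) ^+ 2 in w1 *; set a : R := n%:R * n.-1`!%:R in trH *.
have b0 : 0 <= b by rewrite addr_ge0 ?sqr_ge0.
have a0 : 0 <= a by rewrite mulr_ge0.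
rewrite expRN -[leLHS]mul1r ler_pdivrMr ?expR_gt0 //; apply: (le_trans w1).
have -> : gauss_const R n kappa * coset_weight g * d ^+ (2 * m) * expR (2 * pi * u) =
    coset_weight g * ((b * a) ^+ m * (d ^+ 2) ^+ m * ((n%:R * kappa) ^+ (n.-1 * m) *
      ((n.-1 * m)`!%:R * expR (2 * pi * u)))).
  by rewrite -exprM /gauss_const -/a -/b -/m; ring.
rewrite ler_wpM2l //.
apply: (@le_trans _ _ ((b * (a * d ^+ 2 * \tr K ^+ n.-1)) ^+ m)).
  have trH0 : 0 <= \tr H.
    rewrite /H /siegel_gram raddfD /=.
    by rewrite addr_ge0 //; apply: sumr_ge0 => i _; rewrite mxE sumr_ge0 // => l _;
      rewrite [_^T _ _]mxE -expr2 sqr_ge0.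
  have h1 : 0 <= b * \tr H by rewrite mulr_ge0.
  have h2 : b * \tr H <= b * (a * d ^+ 2 * \tr K ^+ n.-1) by rewrite ler_wpM2l.
  by rewrite lerXn2r ?nnegrE //; exact: le_trans h2.
have -> : (b * (a * d ^+ 2 * \tr K ^+ n.-1)) ^+ m =
    (b * a) ^+ m * (d ^+ 2) ^+ m * \tr K ^+ (n.-1 * m).
  by rewrite exprM -!exprMn; congr (_ ^+ m); ring.
rewrite ler_wpM2l //; first by apply: mulr_ge0; apply: exprn_ge0; [exact: mulr_ge0|exact: sqr_ge0].
apply: (@le_trans _ _ ((n%:R * kappa * u) ^+ (n.-1 * m))).
  by rewrite lerXn2r ?nnegrE //; exact: le_trans Ku.
by rewrite exprMn ler_wpM2l // exprn_ge0 // ltW.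
Qed.

Lemma Lambda_int {R : realType} n (T : 'M[R]_n) : Lambda T ->
  exists A : 'M[int]_n, 2 *: T = intmx R A.
Proof.
move=> [_ Td To].
have h i j : 2 * T i j \is a Num.int.
  have [->|ij] := eqVneq i j; last exact: To.
  by rewrite rpredM // rpred_nat.
exists (\matrix_(i, j) Num.floor (2 * T i j)).
by apply/matrixP => i j; rewrite !mxE floorK.
Qed.

(** By Cramer's rule: [det (2 T)] is a nonzero integer, so [|det T| >= 2^-n], and the entries of [T]
    are bounded by its trace. *)
Lemma Lambda_inv_le {R : realType} n (T : 'M[R]_n) (t : R) :
  Lambda T -> \tr T <= t ->
  forall i j, `|(invmx T) i j| <= 2 ^+ n * (n.-1`!%:R * t ^+ n.-1).
Proof.
move=> LT Tt i j; have [pT _ _] := LT; have uT := posdef_unit _ _ pT.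
have [sT qT] := pT.
have Tle a b : `|T a b| <= t.
  apply: le_trans Tt; apply: psd_entry_le => // x.
  have [->|x0] := eqVneq x 0; last exact/ltW/qT.
  by rewrite mulmx0 mxE.
have dT : 1 <= 2 ^+ n * `|\det T|.
  have [A TA] := Lambda_int _ _ LT.
  have := congr1 determinant TA; rewrite detZ det_map_mx => dA.
  have -> : 2 ^+ n * `|\det T| = `|2 ^+ n * \det T|.
    by rewrite normrM ger0_norm // exprn_ge0.
  rewrite dA -intr_norm -[1]/(1%:~R) ler_int -gtz0_ge1 normr_gt0.
  rewrite -(intr_eq0 R) -dA mulf_neq0 ?expf_neq0 ?pnatr_eq0 //.
  by rewrite -unitfE -unitmxE.
have d0 : 0 < `|\det T| by rewrite normr_gt0 -unitfE -unitmxE.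
rewrite /invmx uT mxE normrM normfV ler_pdivrMl //.
have := adj_norm_le _ _ _ Tle i j => aij; apply: (le_trans aij).
rewrite [leRHS](_ : _ = (2 ^+ n * `|\det T|) * (n.-1`!%:R * t ^+ n.-1)); last by ring.
by apply: ler_peMl => //; exact: le_trans (normr_ge0 _) aij.
Qed.

(** At height 2 the exponent is [-4 pi tr (T H^-1)]; it is kept as twice a half because the halves
    are spent separately. *)
Lemma normc_poincare_term {R : realType} n (k : nat) (g : 'M[int]_(n + n)) (X T : 'M[R]_n) :
  g^T *m symplJ n *m g = symplJ n -> X^T = X -> T^T = T ->
  normc (poincare_term k%:Z T (point_over X 2) g) =
  (normc (\det (siegel_denom g (point_over X 2))) ^+ k)^-1 *
  expR (- (2 * (2 * pi * \tr (T *m invmx (siegel_gram g X 2))))).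
Proof.
move=> gJ sX sT; rewrite /poincare_term ComplexField.Normc.normcM.
rewrite -[emx _]/(e2pi _) normc_e2pi Im_tr_act //; congr (_ * _).
  rewrite -exprz_inv -exprnP; elim: k => [|k IHk].
    by rewrite !expr0 invr1 ComplexField.Normc.normc1.
  rewrite exprS ComplexField.Normc.normcM IHk ComplexField.Normc.normcV.
  by rewrite exprS invfM.
by congr expR; ring.
Qed.

(** * Terms of the series and their twisted averages *)

(** One half of the exponential pays for the coset weight through [exp_trace_le], at the price of
    [d ^ (2 m)]; the other half remains for the cosets with [C = 0], where [d] gives no decay. *)
Lemma poincare_term_le {R : realType} n (k : nat) (g : 'M[int]_(n + n)) (X T : 'M[R]_n)
    (kappa : R) (m := #|{: 'I_n * 'I_(n + n)}|)
    (d := normc (\det (siegel_denom g (point_over X 2)))) :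
  (0 < n)%N -> g^T *m symplJ n *m g = symplJ n ->
  X^T = X -> (forall i j, `|X i j| <= 2) -> (2 * m <= k)%N ->
  posdefmx T -> 0 < kappa -> (forall i j, `|(invmx T) i j| <= kappa) ->
  normc (poincare_term k%:Z T (point_over X 2) g) <=
  gauss_const R n kappa * coset_weight g *
    ((d ^+ (k - 2 * m))^-1 *
     expR (- (2 * pi * \tr (T *m invmx (siegel_gram g X 2))))).
Proof.
move=> n0 gJ sX X2 mk pT k0 Tk; rewrite normc_poincare_term //; last exact: pT.1.
have := exp_trace_le _ _ _ _ _ n0 gJ sX X2 pT k0 Tk; rewrite -/m -/d.
set v := 2 * pi * _; set Ew := gauss_const _ _ _ * _ => Ev.
have d0 : 0 < d.
  exact: lt_le_trans (exprn_gt0 _ _) (normc_det_denom_ge _ _ _ 2 gJ sX _).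
have -> : expR (- (2 * v)) = expR (- v) * expR (- v).
  by rewrite -expRD; congr expR; ring.
rewrite -[X in d ^+ X](subnK mk) exprD invfM !mulrA ler_wpM2r ?expR_ge0 //.
rewrite -mulrA [leLHS]mulrC; apply: ler_wpM2r.
  by rewrite invr_ge0 exprn_ge0 // ltW.
by rewrite [leLHS]mulrC ler_pdivrMr // exprn_gt0.
Qed.

Lemma gauss_const_ge0 {R : realType} n (kappa : R) : 0 <= kappa -> 0 <= gauss_const R n kappa.
Proof.
by move=> k0; apply: mulr_ge0; [apply: exprn_ge0|apply: mulr_ge0; rewrite ?exprn_ge0];
  rewrite ?mulr_ge0 // ?addr_ge0 ?sqr_ge0.
Qed.

(** Each pair of symmetric off-diagonal positions contributes [2 T_ij S_ij], an integer by
    half-integrality. *)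
Lemma tr_Lambda_int {R : realType} n (T : 'M[R]_n) (S : 'M[int]_n) :
  Lambda T -> S^T = S -> \tr (T *m intmx R S) \is a Num.int.
Proof.
move=> [[sT _] Td To] sS; rewrite /mxtrace.
pose F i j := T i j * (S i j)%:~R.
have FC i j : F i j = F j i by rewrite /F -{1}sT -{1}sS !mxE.
have -> : \sum_i (T *m intmx R S) i i = \sum_i \sum_j F i j.
  by apply: eq_bigr => i _; rewrite mxE; apply: eq_bigr => j _; rewrite mxE /F -{1}sS mxE.
have -> : \sum_i \sum_j F i j = \sum_i (F i i + \sum_(j < n | (i < j)%N) 2 * F i j).
  rewrite big_split /=.
  have E : \sum_(i < n) \sum_(j < n | (i < j)%N) 2 * F i j =
      \sum_(i < n) \sum_(j < n | (i < j)%N) F i j +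
      \sum_(i < n) \sum_(j < n | (j < i)%N) F i j.
    rewrite [X in _ + X](exchange_big_dep xpredT) //= -big_split /=.
    apply: eq_bigr => i _; rewrite -big_split /=; apply: eq_bigr => j _.
    by rewrite (FC j i); ring.
  rewrite E addrA -!big_split /=; apply: eq_bigr => i _.
  rewrite (bigD1 i) //= -addrA; congr (_ + _).
  rewrite (bigID (fun j : 'I_n => (i < j)%N)) /=; congr (_ + _); apply: eq_bigl => j.
    by rewrite -val_eqE /=; case: ltngtP.
  by rewrite -val_eqE /=; case: ltngtP.
apply: rpred_sum => i _; apply: rpredD; first by rewrite rpredM ?Td // intr_int.
apply: rpred_sum => j ij; rewrite /F mulrA rpredM ?intr_int //.
by apply: To; rewrite -val_eqE /= neq_ltn ij.
Qed.

(** With [C = 0], [D] is the inverse transpose of [A], so g(Z) is [A Z A^T + B A^T]; the second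
    summand is integral and symmetric and does not affect the exponential. *)
Lemma poincare_term_parabolic {R : realType} n (k : nat) (g : 'M[int]_(n + n))
    (T : 'M[R]_n) (Z : 'M[R[i]]_n) (U := intmx R (ulsubmx g)) :
  g^T *m symplJ n *m g = symplJ n -> dlsubmx g = 0 -> Lambda T ->
  poincare_term k%:Z T Z g =
  ((\det (ulsubmx g)) ^+ k)%:~R * e2pi (\tr (toC (U^T *m T *m U) *m Z)).
Proof.
move=> gJ C0 LT; have [_ _ _ E2 [E3 _]] := symplectic_blocks _ _ gJ.
set A := ulsubmx g in U E3 *; set B := ursubmx g in E2; set D := drsubmx g in E2 E3.
have AD : A^T *m D = 1%:M by rewrite -E3 C0 trmx0 mul0mx subr0.
have DA : D *m A^T = 1%:M by exact: mulmx1C.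
have DE : siegel_denom g Z = intmx R[i] D.
  by rewrite /siegel_denom C0 [intmx _ 0]map_mx0 mul0mx add0r.
have uD : intmx R[i] D \in unitmx.
  by have := congr1 (@intmx R[i] n n) DA; rewrite intmxM [RHS]map_mx1 => /mulmx1_unit[].
have iD : invmx (intmx R[i] D) = intmx R[i] A^T.
  by apply: (can_inj (mulKmx uD)); rewrite mulmxV // -intmxM DA [RHS]map_mx1.
rewrite /poincare_term DE; congr (_ * _).
  rewrite det_map_mx -exprz_inv -exprnP rmorphXn /=; congr (_ ^+ _).
  have dAD : \det A * \det D = 1 by rewrite -[\det A]det_tr -det_mulmx AD det1.
  have dD0 : (\det D)%:~R != 0 :> R[i].
    by rewrite intr_eq0; apply: contra_eq_neq dAD => ->; rewrite mulr0.
  by apply: (mulIf dD0); rewrite mulVf // -intrM dAD.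
rewrite -[emx _]/(e2pi _) /siegel_act DE iD mulmxDl.
have sS : (B *m A^T)^T = B *m A^T.
  rewrite trmx_mul trmxK -[A *m _]mulmx1 -DA -!mulmxA [B^T *m _]mulmxA E2.
  by rewrite !mulmxA -[A *m D^T]trmxK trmx_mul trmxK DA trmx1 mul1mx.
have /intrP[z zE] := tr_Lambda_int _ _ _ LT sS.
rewrite mulmxDr raddfD /= e2piD.
have -> : toC T *m (intmx R[i] B *m intmx R[i] A^T) = toC (T *m intmx R (B *m A^T)).
  by rewrite -intmxM intmx_toC -map_mxM.
rewrite trace_map_mx zE rmorph_int e2pi_int mulr1; congr e2pi.
rewrite mulmxA mxtrace_mulC !map_mxM /U intmxT -!intmx_toC.
by rewrite !mulmxA.
Qed.

(* Symmetrizing instead of indexing by i <= j makes tr(S X) a sum over all pairs of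
   independent terms with integral coefficients 2 S_ij; cf. [tr_grid_point]. *)
Definition grid_point {R : realType} {n M} (f : {ffun 'I_n * 'I_n -> 'I_M}) : 'M[R]_n :=
  \matrix_(i, j) (((f (i, j))%:R + (f (j, i))%:R) / M%:R).

Lemma grid_point_sym {R : realType} n M (f : {ffun 'I_n * 'I_n -> 'I_M}) :
  (grid_point f : 'M[R]_n)^T = grid_point f.
Proof. by apply/matrixP => i j; rewrite !mxE addrC. Qed.

Lemma grid_point_le {R : realType} n M (f : {ffun 'I_n * 'I_n -> 'I_M}) i j :
  `|(grid_point f : 'M[R]_n) i j| <= 2.
Proof.
have M0 : 0 < M%:R :> R by rewrite ltr0n; case: M f => // f; case: (f (i, j)).
have fM p : (f p)%:R <= M%:R :> R by rewrite ler_nat ltnW.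
rewrite mxE ger0_norm; last by rewrite divr_ge0 // addr_ge0.
by rewrite ler_pdivrMr // mulrDl mul1r lerD.
Qed.

Lemma tr_grid_point {R : realType} n M (f : {ffun 'I_n * 'I_n -> 'I_M}) (S : 'M[R]_n)
    (A : 'M[int]_n) : S^T = S -> 2 *: S = intmx R A ->
  \tr (S *m grid_point f) = \sum_p (A p.1 p.2)%:~R * (f p)%:R / M%:R.
Proof.
move=> sS SA.
have AE i j : (A i j)%:~R = 2 * S i j by have := (congr1 (fun N : 'M[R]_n => N i j) SA); rewrite !mxE.
have -> : \sum_p (A p.1 p.2)%:~R * (f p)%:R / M%:R =
   \sum_i \sum_j S i j * (f (i, j))%:R / M%:R + \sum_i \sum_j S i j * (f (i, j))%:R / M%:R.
  transitivity (\sum_p (A p.1 p.2)%:~R * (f (p.1, p.2))%:R / M%:R : R).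
    by apply: eq_bigr => -[i j].
  rewrite -(pair_bigA _ (fun i j => (A i j)%:~R * (f (i, j))%:R / M%:R)) -big_split /=.
  apply: eq_bigr => i _; rewrite -big_split /=; apply: eq_bigr => j _.
  by rewrite AE; ring.
rewrite [X in _ = _ + X]exchange_big -big_split /=; apply: eq_bigr => i _.
rewrite mxE -big_split /=; apply: eq_bigr => j _.
have -> : S j i = S i j by rewrite -{1}sS mxE.
by rewrite mxE; ring.
Qed.

Definition twisted_term {R : realType} {n} (M k : nat) (T T' : 'M[R]_n)
    (g : 'M[int]_(n + n)) (f : {ffun 'I_n * 'I_n -> 'I_M}) : R[i] :=
  e2pi (- (\tr (T' *m grid_point f))%:C%C) *
    poincare_term k%:Z T (point_over (grid_point f) 2) g.

(* The contribution of the coset of g to the T'-th finite Fourier coefficient of P_T. *)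
Definition twisted_average {R : realType} {n} (M k : nat) (T T' : 'M[R]_n)
    (g : 'M[int]_(n + n)) : R[i] :=
  (#|{: {ffun 'I_n * 'I_n -> 'I_M}}|%:R)^-1 *
  \sum_(f : {ffun 'I_n * 'I_n -> 'I_M}) twisted_term M k T T' g f.

Lemma normc_sum_le {R : realType} (J : Type) (r : seq J) (z : J -> R[i]) :
  normc (\sum_(j <- r) z j) <= \sum_(j <- r) normc (z j).
Proof.
elim: r => [|j r IHr]; first by rewrite !big_nil ComplexField.Normc.normc0.
by rewrite !big_cons; apply: (le_trans (normcD_le _ _)); rewrite lerD2l.
Qed.

Lemma normc_ge0 {R : realType} (z : R[i]) : 0 <= normc z.
Proof. by case: z => a b /=; exact: sqrtr_ge0. Qed.

Lemma normc_real {R : realType} (a : R) : normc a%:C%C = `|a|.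
Proof. by rewrite /= expr0n /= addr0 sqrtr_sqr. Qed.

Lemma normc_natV {R : realType} m : normc ((m%:R : R[i])^-1) = m%:R^-1 :> R.
Proof.
rewrite ComplexField.Normc.normcV -(rmorph_nat (real_complex R)) normc_real.
by rewrite ger0_norm.
Qed.

Lemma normc_average_le {R : realType} (J : finType) (z : J -> R[i]) (B : R) :
  0 <= B -> (forall j, normc (z j) <= B) ->
  normc ((#|J|%:R)^-1 * \sum_j z j) <= B.
Proof.
move=> B0 zB; rewrite ComplexField.Normc.normcM normc_natV.
have [J0|J0] := posnP #|J|; first by rewrite J0 invr0 mul0r.
rewrite mulrC ler_pdivrMr ?ltr0n // (le_trans (normc_sum_le _ _ _)) //.
apply: (@le_trans _ _ (\sum_(j : J) B)); first exact: ler_sum.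
by rewrite sumr_const mulr_natr.
Qed.

Lemma normc_twisted_term {R : realType} n M k (T T' : 'M[R]_n) (g : 'M[int]_(n + n))
    (f : {ffun 'I_n * 'I_n -> 'I_M}) :
  normc (twisted_term M k T T' g f) =
  normc (poincare_term k%:Z T (point_over (grid_point f) 2) g).
Proof.
by rewrite ComplexField.Normc.normcM normc_e2pi /= oppr0 mulr0 oppr0 expR0 mul1r.
Qed.

Lemma mxtrace_point {R : realType} n (S X : 'M[R]_n) (y : R) :
  \tr (toC S *m point_over X y) = Complex (\tr (S *m X)) (y * \tr S).
Proof.
rewrite mulmxDr raddfD /= -map_mxM mul_mx_scalar mxtraceZ !trace_map_mx.
by apply/eqP; rewrite eq_complex /=; apply/andP; split; apply/eqP; ring.
Qed.

(** The grid point enters only through the additive character of frequency [S - T']; the other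
    factor can be taken out of the average. *)
Lemma twisted_term_parabolic {R : realType} n M k (T T' : 'M[R]_n)
    (g : 'M[int]_(n + n)) (f : {ffun 'I_n * 'I_n -> 'I_M}) (U := intmx R (ulsubmx g))
    (S := U^T *m T *m U) :
  g^T *m symplJ n *m g = symplJ n -> dlsubmx g = 0 -> Lambda T ->
  twisted_term M k T T' g f =
  (((\det (ulsubmx g)) ^+ k)%:~R * (expR (- (2 * pi * (2 * \tr S))))%:C%C) *
    e2pi ((\tr ((S - T') *m grid_point f))%:C%C).
Proof.
move=> gJ C0 LT; rewrite /twisted_term poincare_term_parabolic // -/U -/S.
rewrite mxtrace_point.
have -> : Complex (\tr (S *m grid_point f)) (2 * \tr S) =
    (\tr (S *m grid_point f))%:C%C + Complex 0 (2 * \tr S).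
  by apply/eqP; rewrite eq_complex /= addr0 add0r !eqxx.
have eE : e2pi (Complex 0 (2 * \tr S)) = (expR (- (2 * pi * (2 * \tr S))))%:C%C.
  by rewrite e2piE mulr0 cos0 sin0 (_ : Complex 1 0 = 1) ?mulr1.
have -> : (\tr ((S - T') *m grid_point f))%:C%C =
    - (\tr (T' *m grid_point f))%:C%C + (\tr (S *m grid_point f))%:C%C.
  by rewrite mulmxBl raddfB /= rmorphB /= addrC.
by rewrite !e2piD eE; ring.
Qed.

Lemma twisted_average_main {R : realType} n M k (T T' : 'M[R]_n)
    (g : 'M[int]_(n + n)) (U := intmx R (ulsubmx g)) :
  (0 < M)%N -> g^T *m symplJ n *m g = symplJ n -> dlsubmx g = 0 -> Lambda T ->
  U^T *m T *m U = T' ->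
  twisted_average M k T T' g =
  ((\det (ulsubmx g)) ^+ k)%:~R * (expR (- (2 * pi * (2 * \tr T'))))%:C%C.
Proof.
move=> M0 gJ C0 LT TT'; rewrite /twisted_average.
under eq_bigr => f _ do
  rewrite twisted_term_parabolic // -/U TT' subrr mul0mx mxtrace0 e2pi0 mulr1.
set z := _ * (expR _)%:C%C; rewrite sumr_const -[z *+ _]mulr_natl mulKf // pnatr_eq0 -lt0n.
by rewrite card_ffun card_ord expn_gt0 M0.
Qed.

Lemma tr_invmx_siegel_gram_ge0 {R : realType} n (g : 'M[int]_(n + n)) (X T : 'M[R]_n) :
  g^T *m symplJ n *m g = symplJ n -> X^T = X -> posdefmx T ->
  0 <= \tr (T *m invmx (siegel_gram g X 2)).
Proof.
move=> gJ sX pT; have [B ->] := invmx_siegel_gram _ _ _ _ (gram_unit _ g X 2 gJ sX (ltr0n R 2)).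
rewrite tr_mul_gram; apply: sumr_ge0 => j _.
have [->|x0] := eqVneq (col j B) 0; last exact/ltW/pT.2.
by rewrite mulmx0 mxE.
Qed.

(** Here [H = D D^T] and [A^T D = 1], whatever [X] is. *)
Lemma invmx_siegel_gram_parabolic {R : realType} n (g : 'M[int]_(n + n)) (X : 'M[R]_n) :
  g^T *m symplJ n *m g = symplJ n -> X^T = X -> dlsubmx g = 0 ->
  invmx (siegel_gram g X 2) = intmx R (ulsubmx g) *m (intmx R (ulsubmx g))^T.
Proof.
move=> gJ sX C0; have [_ _ _ _ [E3 E4]] := symplectic_blocks _ _ gJ.
have uH := gram_unit _ g X 2 gJ sX (ltr0n R 2).
apply: (can_inj (mulKmx uH)); rewrite mulmxV // /siegel_gram C0.
rewrite [intmx R 0]map_mx0 mul0mx scaler0 mul0mx addr0 add0r !intmxT -!intmxM.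
have DA : (drsubmx g)^T *m ulsubmx g = 1%:M by rewrite -E4 C0 mulmx0 subr0.
have AD : (ulsubmx g)^T *m drsubmx g = 1%:M by rewrite -E3 C0 trmx0 mul0mx subr0.
rewrite mulmxA -[_ *m (drsubmx g)^T *m _]mulmxA DA mulmx1 (mulmx1C AD).
by rewrite [RHS]map_mx1.
Qed.

Lemma normc_twisted_average_le {R : realType} n M k (T T' : 'M[R]_n)
    (g : 'M[int]_(n + n)) (t : R) (U := intmx R (ulsubmx g))
    (m := #|{: 'I_n * 'I_(n + n)}|)
    (kappa := 2 ^+ n * (n.-1`!%:R * t ^+ n.-1)) :
  (0 < n)%N -> g^T *m symplJ n *m g = symplJ n -> Lambda T -> Lambda T' ->
  1 <= t -> \tr T <= t -> \tr T' <= t -> (2 * m <= k)%N -> 2 * t + 2 * k%:R <= M%:R ->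
  (dlsubmx g = 0 -> U^T *m T *m U <> T') ->
  normc (twisted_average M k T T' g) <=
  (2 ^+ (k - 2 * m))^-1 * (gauss_const R n kappa * coset_weight g).
Proof.
move=> n0 gJ LT LT' t1 Tt T't mk MM nTT'.
have [pT _ _] := LT; have [pT' _ _] := LT'.
have t0 : 0 < t by exact: lt_le_trans t1.
have k0 : 0 < kappa by rewrite !mulr_gt0 ?exprn_gt0 // ltr0n fact_gt0.
have Ew0 : 0 <= gauss_const R n kappa * coset_weight g.
  by rewrite mulr_ge0 ?coset_weight_ge0 ?gauss_const_ge0 // ltW.
have eps0 : 0 <= (2 ^+ (k - 2 * m))^-1 :> R by rewrite invr_ge0 exprn_ge0.
have Bd (f : {ffun 'I_n * 'I_n -> 'I_M}) := poincare_term_le _ k _ _ T kappa n0 gJ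
  (grid_point_sym _ _ f) (grid_point_le _ _ f) mk pT k0 (Lambda_inv_le _ _ _ LT Tt).
have Nm (f : {ffun 'I_n * 'I_n -> 'I_M}) := normc_poincare_term _ k _ _ T gJ
  (grid_point_sym _ _ f) pT.1.
(* For [C <> 0] the rank is at least 1, so [|det W| >= 2] at every grid point and the power of the
   determinant gives the required factor. *)
have [C0|C0] := eqVneq (dlsubmx g) 0; last first.
  apply: normc_average_le => [|f]; first exact: mulr_ge0.
  rewrite normc_twisted_term; apply: (le_trans (Bd f)); rewrite [leRHS]mulrC.
  rewrite ler_wpM2l //.
  have uden f := normc_det_denom_ge _ _ _ 2 gJ (grid_point_sym n M f) (ltr0n R 2).
  have d2 : 2 <= normc (\det (siegel_denom g (point_over (grid_point f : 'M[R]_n) 2))).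
    apply: le_trans (uden f); rewrite -[leLHS]expr1 ler_eXn2l ?ltr1n //.
    rewrite lt0n mxrank_eq0; apply: contra C0 => /eqP C0; apply/eqP/matrixP => i j.
    have := congr1 (fun N : 'M[R]_n => N i j) C0; rewrite !mxE.
    by move=> /eqP; rewrite intr_eq0 => /eqP.
  apply: (@le_trans _ _ ((2 ^+ (k - 2 * m))^-1 * 1)); last by rewrite mulr1.
  apply: ler_pM; rewrite ?invr_ge0 ?exprn_ge0 ?normc_ge0 ?expR_ge0 //.
    rewrite lef_pV2 ?posrE ?exprn_gt0 ?(lt_le_trans _ d2) //.
    by rewrite lerXn2r ?nnegrE // normc_ge0.
  rewrite -[leRHS]expR0 ler_expR oppr_le0; apply: mulr_ge0.
    by rewrite mulr_ge0 ?pi_ge0.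
  exact: tr_invmx_siegel_gram_ge0 _ _ _ _ gJ (grid_point_sym n M f) pT.
have {}nTT' := nTT' C0; set S := U^T *m T *m U in nTT'.
have [A TA] := Lambda_int _ _ LT; have [A' TA'] := Lambda_int _ _ LT'.
have sT := pT.1; have sT' := pT'.1.
have sS : S^T = S by rewrite /S !trmx_mul trmxK sT mulmxA.
pose d := (ulsubmx g)^T *m A *m ulsubmx g - A'.
have dE : 2 *: (S - T') = intmx R d.
  rewrite scalerBr TA' /S scalemxAl scalemxAr TA /d.
  by rewrite [RHS]map_mxB /U intmxT -!intmxM.
have [p dp] : exists p : 'I_n * 'I_n, d p.1 p.2 != 0.
  apply: contra_notP nTT' => nE; apply/eqP; rewrite -subr_eq0.
  have d0 : d = 0.
    apply/matrixP => i j; rewrite [RHS]mxE; apply/eqP.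
    by apply: contra_notT nE => dij; exists (i, j).
  have := dE; rewrite d0 [intmx R 0]map_mx0 => /eqP.
  by rewrite scaler_eq0 pnatr_eq0.
(* For [C = 0] the frequency [d = 2 (S - T')] is integral and nonzero. If its entries are smaller
   than [M], the character sum vanishes. *)
have [dM|] := pselect (forall p : 'I_n * 'I_n, (`|d p.1 p.2| < M)%N).
  suff -> : twisted_average M k T T' g = 0.
    by rewrite ComplexField.Normc.normc0 mulr_ge0.
  rewrite /twisted_average.
  have sST : (S - T')^T = S - T' by rewrite linearB /= sS sT'.
  under eq_bigr => f _.
    rewrite (twisted_term_parabolic _ _ _ _ _ _ _ gJ C0 LT).
    rewrite (tr_grid_point _ _ _ _ d sST dE).
    over.
  by rewrite -mulr_sumr (char_sum_prod _ _ (fun p => d p.1 p.2) p dp dM) !mulr0.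
(* Aliasing: some entry of the frequency reaches [M]. Then [S] has a large entry, the lower bound on
   [M] gives [tr S >= k], and the remaining [exp(-2 pi tr S)] is at most [2^-k]. *)
move=> /existsNP[q /negP]; rewrite -leqNgt => dq.
have trS : k%:R <= \tr S.
  have Sq : `|S q.1 q.2| <= \tr S.
    apply: psd_entry_le => // x.
    have -> : x^T *m S *m x = (U *m x)^T *m T *m (U *m x).
      by rewrite trmx_mul !mulmxA.
    have [->|x0] := eqVneq (U *m x) 0; last exact/ltW/pT.2.
    by rewrite mulmx0 mxE.
  have T'q : `|T' q.1 q.2| <= t.
    apply: le_trans T't; apply: psd_entry_le => // x.
    have [->|x0] := eqVneq x 0; last exact/ltW/pT'.2.
    by rewrite mulmx0 mxE.
  have Mq : M%:R <= 2 * (`|S q.1 q.2| + `|T' q.1 q.2|).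
    apply: (@le_trans _ _ (`|d q.1 q.2|%N%:R)); first by rewrite ler_nat.
    have := congr1 (fun N : 'M[R]_n => N q.1 q.2) dE; rewrite !mxE => dqE.
    rewrite natr_absz intr_norm -dqE normrM ger0_norm // ler_wpM2l //.
    exact: ler_normB.
  lra.
apply: normc_average_le => [|f]; first exact: mulr_ge0.
set v := \tr (T *m invmx (siegel_gram g (grid_point f : 'M[R]_n) 2)).
have vS : v = \tr S.
  rewrite /v invmx_siegel_gram_parabolic ?grid_point_sym //.
  by rewrite mulmxA mxtrace_mulC mulmxA.
rewrite normc_twisted_term; apply: (le_trans (Bd f)); rewrite [leRHS]mulrC.
rewrite ler_wpM2l // -/v vS.
set e := expR _; rewrite -[leRHS]mul1r.
have den1 : 1 <= normc (\det (siegel_denom g (point_over (grid_point f : 'M[R]_n) 2))).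
  apply: le_trans (normc_det_denom_ge _ _ _ 2 gJ (grid_point_sym n M f) (ltr0n R 2)).
  by rewrite exprn_ege1 // ler1n.
apply: ler_pM; rewrite ?invr_ge0 ?exprn_ge0 ?normc_ge0 ?expR_ge0 //.
  by rewrite invf_le1 ?exprn_ege1 // exprn_gt0 // (lt_le_trans _ den1).
apply: (@le_trans _ _ ((2 ^+ k)^-1)); last first.
  by rewrite lef_pV2 ?posrE ?exprn_gt0 // ler_eXn2l ?ltr1n // leq_subr.
rewrite /e expRN lef_pV2 ?posrE ?expR_gt0 ?exprn_gt0 //.
apply: (@le_trans _ _ (expR 1 ^+ k)).
  by rewrite lerXn2r ?nnegrE ?expR_ge0 //; have := expR_ge1Dx (1 : R); lra.
rewrite -expRM_natr mul1r ler_expR; apply: (le_trans trS).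
rewrite -[leLHS]mul1r ler_wpM2r //; first exact: le_trans trS.
by have := pi_ge2 R; lra.
Qed.

(** * Cosets and linear independence *)

Lemma Gamma0_symplectic n N (g : Gamma0_type n N) :
  (val g)^T *m symplJ n *m val g = symplJ n.
Proof. by case: g => g /= /andP[/eqP]. Qed.

Lemma Gamma0_1 n N : @Gamma0 n N 1%:M.
Proof.
apply/andP; split; first by rewrite trmx1 mul1mx mulmx1.
apply/forallP => i; apply/forallP => j.
by rewrite (scalar_mx_block n n 1) block_mxKdl mxE dvdz0.
Qed.

Lemma symplectic_unipotent n (h : 'M[int]_(n + n)) :
  h^T *m symplJ n *m h = symplJ n -> dlsubmx h = 0 -> drsubmx h = 1%:M -> Gamma_oo h.
Proof.
move=> hJ C0 D1; have [_ _ _ E2 [E3 _]] := symplectic_blocks _ _ hJ.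
exists false, (ursubmx h); split.
  by move: E2; rewrite D1 mulmx1 trmx1 mul1mx.
rewrite expr0 scale1r -{1}[h]submxK C0 D1.
move: E3; rewrite C0 D1 trmx0 mul0mx subr0 mulmx1 => /(congr1 trmx).
by rewrite trmxK trmx1 => ->.
Qed.

(** If [g] and [g'] have the same bottom rows, then [g' g^-1] is symplectic with bottom rows
    [(0, 1)], hence lies in [Gamma_oo]. *)
Lemma Gamma_coset_inj n N (x y : Gamma_coset n N) :
  (forall p : 'I_n * 'I_(n + n),
     dsubmx (val (repr x)) p.1 p.2 = dsubmx (val (repr y)) p.1 p.2) -> x = y.
Proof.
move=> xy; rewrite -[x]reprK -[y]reprK; apply/eqmodP/asboolP.
have gJ := Gamma0_symplectic _ _ (repr x); have g'J := Gamma0_symplectic _ _ (repr y).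
have {}xy : dsubmx (val (repr x)) = dsubmx (val (repr y)).
  by apply/matrixP => i j; exact: (xy (i, j)).
move: (val (repr x)) (val (repr y)) gJ g'J xy => g g' gJ g'J gg'.
have gi := symplectic_inv _ _ gJ.
set gI := block_mx _ _ _ _ in gi; have ig := mulmx1C gi.
exists (g' *m gI); last by rewrite -mulmxA ig mulmx1.
have dh : dsubmx (g' *m gI) = dsubmx 1%:M.
  by rewrite -mul_dsub_mx -gg' mul_dsub_mx gi.
have d1 : dsubmx (1%:M : 'M[int]_(n + n)) = row_mx 0 1%:M.
  by rewrite (scalar_mx_block n n 1) /block_mx col_mxKd.
apply: symplectic_unipotent.
- have gIJ : gI^T *m symplJ n *m gI = symplJ n.
    by rewrite -{1}gJ -!mulmxA gi mulmx1 mulmxA -trmx_mul gi trmx1 mul1mx.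
  by rewrite trmx_mul -!mulmxA [g'^T *m _]mulmxA [_ *m symplJ n *m _]mulmxA g'J mulmxA.
- by rewrite /dlsubmx dh d1 row_mxKl.
- by rewrite /drsubmx dh d1 row_mxKr.
Qed.

Definition base_coset n N : Gamma_coset n N :=
  \pi_(Gamma_coset n N)%qT (exist _ 1%:M (Gamma0_1 n N) : Gamma0_type n N).

(** [repr] picks some element of the identity coset, known only up to [Gamma_oo]; hence the sign. *)
Lemma base_cosetP n N (g := val (repr (base_coset n N))) :
  dlsubmx g = 0 /\ exists b : bool, ulsubmx g = (-1) ^+ b *: 1%:M.
Proof.
have /eqmodP/asboolP[m [b [S [_ ->]]]] :
    (exist _ 1%:M (Gamma0_1 n N) : Gamma0_type n N) = repr (base_coset n N)
      %[mod Gamma_coset n N]%qT by rewrite reprK.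
rewrite -/g /= mulmx1 => ->; rewrite scale_block_mx block_mxKdl block_mxKul scaler0.
by split=> //; exists b.
Qed.

Lemma Lambda_tr_ge1 {R : realType} n (T : 'M[R]_n) : (0 < n)%N -> Lambda T -> 1 <= \tr T.
Proof.
move=> n0 [[sT pT] Td _]; pose i := Ordinal n0.
have Tjj j : 0 < T j j.
  have := pT (delta_mx j 0); rewrite trmx_delta -rowE -colE !mxE; apply.
  apply/eqP => /matrixP/(_ j 0); rewrite !mxE !eqxx => /eqP.
  by rewrite oner_eq0.
rewrite /mxtrace (bigD1 i) //=.
have /intrP[z zE] := Td i.
apply: (@le_trans _ _ (T i i)); last by rewrite lerDl sumr_ge0 // => j _; exact: ltW.
by have := Tjj i; rewrite zE ltr0z -[1]/(1%:~R) ler_int gtz0_ge1.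
Qed.

(** The entries of [2 T_j] are integers of size at most [2 t], which leaves at most [4 t + 1 <= 5 t]
    values for each. This keeps [h] out of the final constant. *)
Lemma card_Lambda_le {R : realType} n h (T : 'I_h -> 'M[R]_n) (t : R) :
  (forall j, Lambda (T j)) -> injective T -> 1 <= t -> (forall j, \tr (T j) <= t) ->
  h%:R <= (5 * t) ^+ (n * n).
Proof.
move=> LT T_inj t1 Tt.
have /choice[A TA] := fun j => Lambda_int _ _ (LT j).
pose B := Num.truncn (2 * t).
have t0 : 0 <= 2 * t by lra.
have AB j a b : (`|A j a b| <= B)%N.
  have Tle : `|T j a b| <= t.
    have [[sT qT] _ _] := LT j; apply: le_trans (Tt j); apply: psd_entry_le => // x.
    have [->|x0] := eqVneq x 0; last exact/ltW/qT.
    by rewrite mulmx0 mxE.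
  have := congr1 (fun M : 'M[R]_n => M a b) (TA j); rewrite !mxE => TAab.
  rewrite truncn_ge_nat // natr_absz intr_norm -TAab normrM ger0_norm //.
  by rewrite ler_wpM2l.
pose psi j : {ffun 'I_n * 'I_n -> 'I_(B + B.+1)} :=
  [ffun p => insubd (Ordinal (ltn_addl B (ltn0Sn B))) (absz (A j p.1 p.2 + B%:Z))].
have psi_inj : injective psi.
  move=> i j ij; apply: T_inj; apply: (scalerI (a := 2)); first by rewrite pnatr_eq0.
  rewrite !TA; congr intmx; apply/matrixP => a b.
  have := congr1 (fun f : {ffun _ -> _} => val (f (a, b))) ij; rewrite /= !ffunE !val_insubd.
  have := AB i a b; have := AB j a b; move=> Bj Bi; rewrite !ifT /=; lia.
have := leq_card psi psi_inj; rewrite card_ord card_ffun card_ord card_prod !card_ord.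
rewrite -(ler_nat R) natrX => /le_trans; apply.
rewrite lerXn2r ?nnegrE ?mulr_ge0 //; first by lra.
have : B%:R <= 2 * t by rewrite truncn_le.
by rewrite natrD -natr1; lra.
Qed.

(** Absolute convergence at height 2: [|det W| >= 1], so the bound for a single term reduces to a
    constant times the coset weight. *)
Lemma dominated_poincare_term {R : realType} n N (k : nat) (T X : 'M[R]_n) :
  (0 < n)%N -> (2 * #|{: 'I_n * 'I_(n + n)}| <= k)%N -> Lambda T -> X^T = X ->
  (forall i j, `|X i j| <= 2) ->
  cdominated (fun x : Gamma_coset n N => coset_weight (val (repr x)))
    (fun x => poincare_term k%:Z T (point_over X 2) (val (repr x))).
Proof.
move=> n0 mk LT sX X2; have [pT _ _] := LT.
pose t := \tr T; have t1 : 1 <= t by exact: Lambda_tr_ge1.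
pose kappa := 2 ^+ n * (n.-1`!%:R * t ^+ n.-1).
have k0 : 0 < kappa.
  by rewrite !mulr_gt0 ?exprn_gt0 ?ltr0n ?fact_gt0 // (lt_le_trans _ t1).
exists (gauss_const R n kappa) => x; have gJ := Gamma0_symplectic _ _ (repr x).
apply: (le_trans (poincare_term_le _ _ _ _ _ _ n0 gJ sX X2 mk pT k0
  (Lambda_inv_le _ _ _ LT (lexx _)))).
rewrite -[leRHS]mulr1 ler_wpM2l //.
  by rewrite mulr_ge0 ?coset_weight_ge0 ?gauss_const_ge0 // ltW.
have d1 : 1 <= normc (\det (siegel_denom (val (repr x)) (point_over X 2))).
  apply: le_trans (normc_det_denom_ge _ _ _ 2 gJ sX (ltr0n R 2)).
  by rewrite exprn_ege1 // ler1n.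
rewrite -[leRHS]mulr1; apply: ler_pM; rewrite ?invr_ge0 ?exprn_ge0 ?normc_ge0 ?expR_ge0 //.
  by rewrite invf_le1 ?exprn_ege1 // exprn_gt0 // (lt_le_trans _ d1).
rewrite -[leRHS]expR0 ler_expR oppr_le0; apply: mulr_ge0.
  by rewrite mulr_ge0 ?pi_ge0.
exact: tr_invmx_siegel_gram_ge0 _ _ _ _ gJ sX pT.
Qed.

Lemma poly_exp_lt_exp2 {R : realType} (K : R) (q : nat) : 0 <= K ->
  exists2 C : R, 0 <= C & forall (t : R) (k : nat), 1 <= t -> C * t <= k%:R ->
    K * t ^+ q * expR (4 * pi * t) < 2 ^+ k.
Proof.
move=> K0; pose L := K * q`!%:R; have L0 : 0 <= L by rewrite mulr_ge0.
have p0 := pi_ge0 R.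
(* [2^k >= exp(k / 2)] because [exp(1/2) <= 2]. The summands of [4 pi + 1 + L] pay for the given
   exponential, for [t^q <= q! exp t], and for [L < 1 + L t <= exp(L t)]. *)
exists (2 * (4 * pi + 1 + L)) => [|t k t1 Ck].
  by rewrite mulr_ge0 // !addr_ge0 // mulr_ge0.
have t0 : 0 <= t by lra.
have e2 : expR (1 / 2) <= 2 :> R.
  rewrite -[leLHS]invrK -expRN -[leRHS]invrK lef_pV2 ?posrE ?invr_gt0 ?expR_gt0 //.
  by apply: le_trans (expR_ge1Dx _); lra.
apply: (@lt_le_trans _ _ (expR (k%:R / 2))); last first.
  rewrite (_ : k%:R / 2 = (1 / 2) * k%:R); last by ring.
  by rewrite expRM_natr lerXn2r ?nnegrE ?expR_ge0.
apply: (@lt_le_trans _ _ (expR (L * t) * expR t * expR (4 * pi * t))); last first.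
  by rewrite -!expRD ler_expR; nra.
rewrite ltr_pM2r ?expR_gt0 //.
apply: (@le_lt_trans _ _ (L * expR t)).
  by rewrite /L -mulrA ler_wpM2l // exprn_le_expR.
rewrite ltr_pM2r ?expR_gt0 //.
apply: (@lt_le_trans _ _ (1 + L * t)); last exact: expR_ge1Dx.
by nra.
Qed.

(** Used with [kappa = c t^(n-1)]: the dependence of the constant on the traces is a mere power of
    [t]. *)
Lemma gauss_constM {R : realType} n (c t : R) r :
  gauss_const R n (c * t ^+ r) =
  gauss_const R n c * t ^+ (r * (n.-1 * #|{: 'I_n * 'I_(n + n)}|)).
Proof.
rewrite /gauss_const; set m := #|_|.
have -> : (n%:R * (c * t ^+ r)) ^+ (n.-1 * m) =
    (n%:R * c) ^+ (n.-1 * m) * t ^+ (r * (n.-1 * m)).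
  by rewrite mulrA exprMn -exprM.
by ring.
Qed.

(** From a linear relation, the finite Fourier coefficient at [T_j] is formed and divided by [c j].
    The resulting sum over cosets is 0, whereas [rsum_gt0] makes its real part positive. *)
Lemma lin_indep_poincare {R : realType} n N (k h : nat) (T : 'I_h -> 'M[R]_n) (t : R)
    (m := #|{: 'I_n * 'I_(n + n)}|)
    (kappa := 2 ^+ n * (n.-1`!%:R * t ^+ n.-1)) :
  (0 < n)%N -> (forall j, Lambda (T j)) ->
  (forall i j, i != j -> ~ GLequiv (T i) (T j)) ->
  (forall j, automorph_compatible k%:Z (T j)) ->
  1 <= t -> (forall j, \tr (T j) <= t) -> (2 * m <= k)%N ->
  h%:R * ((2 ^+ (k - 2 * m))^-1 * gauss_const R n kappa) * 6 ^+ m < expR (- (4 * pi * t)) ->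
  lin_indep_on (@siegel_half_space R n) (fun j => poincare N k%:Z (T j)).
Proof.
move=> n0 LT neq compat t1 Tt mk small c c0 j0; apply/eqP; apply: contraT => cj0.
(* A coefficient of largest modulus makes all ratios [c i / c j] of modulus at most 1. *)
case: (@Order.TotalTheory.arg_maxP _ _ _ j0 xpredT (fun i => normc (c i)) isT) => j _ jmax.
have cj : 0 < normc (c j).
  apply: (@lt_le_trans _ _ (normc (c j0))); last exact: jmax.
  rewrite lt_neqAle normc_ge0 andbT eq_sym; apply: contra cj0.
  by move=> /eqP/ComplexField.Normc.eq0_normc ->.
have cj_neq0 : c j != 0.
  by apply: contraTneq cj => ->; rewrite ComplexField.Normc.normc0 ltxx.
have kappa0 : 0 < kappa.
  by rewrite !mulr_gt0 ?exprn_gt0 ?ltr0n ?fact_gt0 // (lt_le_trans _ t1).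
pose M := Num.bound (2 * t + 2 * k%:R).
have MM : 2 * t + 2 * k%:R <= M%:R.
  by apply/ltW/archi_boundP; rewrite addr_ge0 // mulr_ge0 //; lra.
have M0 : (0 < M)%N.
  by rewrite -(ltr0n R); apply: lt_le_trans MM; rewrite ltr_wpDr ?mulr_ge0 //; lra.
pose I := Gamma_coset n N.
pose w (x : I) : R := coset_weight (val (repr x)).
have wS : bounded_sums w (6 ^+ m).
  apply: bounded_sums_int_weight => x y xy; apply: Gamma_coset_inj => p; exact: xy.
pose J : finType := ('I_h * {ffun 'I_n * 'I_n -> 'I_M})%type.
pose L : R[i] := (#|{: {ffun 'I_n * 'I_n -> 'I_M}}|%:R)^-1.
(* Coefficients of the averaged relation; [csum_lincomb] exchanges this finite combination with the
   sum over cosets. *)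
pose a (p : J) : R[i] := c p.1 / c j * (L * e2pi (- (\tr (T j *m grid_point p.2))%:C%C)).
pose F (p : J) (x : I) := poincare_term k%:Z (T p.1) (point_over (grid_point p.2) 2)
  (val (repr x)).
have dF p : cdominated w (F p).
  apply: dominated_poincare_term => //; first exact: grid_point_sym.
  exact: grid_point_le.
have [dG sG] := csum_lincomb w _ (index_enum J) a F wS dF.
set G := fun x : I => _ in dG sG.
have G0 : csum G = 0.
  rewrite sG -(pair_bigA _ (fun i f => a (i, f) * csum (F (i, f)))) exchange_big /=.
  apply: big1 => f _.
  have := c0 _ (point_siegel _ _ _ (grid_point_sym _ _ f) (ltr0n R 2)).
  move=> /(congr1 (fun z => (c j)^-1 * (L * e2pi (- (\tr (T j *m grid_point f))%:C%C)) * z)).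
  rewrite mulr0 mulr_sumr => E; rewrite -[RHS]E; apply: eq_bigr => i _.
  by rewrite /a /= -/(poincare _ _ _ _); ring.
have GE x : G x = \sum_i c i / c j * twisted_average M k (T i) (T j) (val (repr x)).
  rewrite /G -(pair_bigA _ (fun i f => a (i, f) * F (i, f) x)).
  apply: eq_bigr => i _; rewrite /twisted_average -/L mulrA mulr_sumr.
  by apply: eq_bigr => f _; rewrite /a /F /twisted_term /=; ring.
pose mu : R := expR (- (2 * pi * (2 * \tr (T j)))).
pose eps := (2 ^+ (k - 2 * m))^-1 * gauss_const R n kappa.
have eps0 : 0 <= eps.
  by rewrite mulr_ge0 ?gauss_const_ge0 ?ltW // invr_gt0 exprn_gt0.
pose x0 := base_coset n N.
(* Terms matching [T_j] equal [mu], a value claimed only at the identity coset and bounded below by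
   0 elsewhere; every other term costs at most [eps * w x]. *)
have term_ge i x : (if (i == j) && (x == x0) then mu else 0) - eps * w x <=
    complex.Re (c i / c j * twisted_average M k (T i) (T j) (val (repr x))).
  set g := val (repr x); have gJ := Gamma0_symplectic _ _ (repr x).
  have ew0 : 0 <= eps * w x by rewrite mulr_ge0 // wS.1.
  have [[C0 TT]|nTT] := pselect (dlsubmx g = 0 /\
     (intmx R (ulsubmx g))^T *m T i *m intmx R (ulsubmx g) = T j).
    have uU : ulsubmx g \in unitmx.
      have [_ _ _ _ [E3 _]] := symplectic_blocks _ _ gJ.
      move: E3; rewrite -/g C0 trmx0 mul0mx subr0 => /mulmx1_unit[].
      by rewrite unitmx_tr.
    have ij : i = j.
      apply/eqP; apply: contraT => /neq nGL; case: nGL.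
      by exists (ulsubmx g).
    rewrite twisted_average_main // ij divff // mul1r.
    (* [U] is an automorph of [T_j], so compatibility fixes the sign and the matching terms cannot
       cancel. *)
    have dk : (\det (ulsubmx g) ^+ k = 1)%R.
      by rewrite exprnP; apply: (compat j) => //; rewrite -{1}ij.
    rewrite dk mulr1z mul1r /= -/mu; case: ifP => _; first by lra.
    by have := expR_gt0 (- (2 * pi * (2 * \tr (T j)))); rewrite -/mu; lra.
  (* At the identity coset [U] is 1 or -1 and fixes [T_j], so an unmatched term is not the
     distinguished one. *)
  have /negPf -> : ~~ ((i == j) && (x == x0)).
    apply/negP => /andP[/eqP ij /eqP xx0]; apply: nTT.
    have [C0 [b Ub]] := base_cosetP n N; rewrite /g xx0 ij; split=> //.
    rewrite -/x0 in Ub *; rewrite Ub.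
    have -> : intmx R ((-1) ^+ b *: 1%:M) = (-1) ^+ b *: 1%:M :> 'M[R]_n.
      by apply/matrixP => u v; rewrite !mxE rmorphM rmorph_sign rmorph_nat.
    have -> : ((-1) ^+ b *: 1%:M : 'M[R]_n)^T = (-1) ^+ b *: 1%:M.
      by rewrite linearZ /= trmx1.
    rewrite -!scalemxAl -scalemxAr mul1mx mulmx1 scalerA.
    by rewrite -expr2 sqrr_sign scale1r.
  rewrite sub0r.
  have vle := normc_twisted_average_le n M k (T i) (T j) g t n0 gJ (LT i) (LT j) t1
    (Tt i) (Tt j) mk MM (fun C0 TT => nTT (conj C0 TT)).
  have /(le_trans (normc_Re _)) : normc (c i / c j * twisted_average M k (T i) (T j) g)
      <= eps * w x.
    rewrite ComplexField.Normc.normcM -[leRHS]mul1r; apply: ler_pM; rewrite ?normc_ge0 //.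
      rewrite ComplexField.Normc.normcM ComplexField.Normc.normcV ler_pdivrMr // mul1r.
      exact: jmax.
    by rewrite /eps -mulrA.
  by rewrite ler_norml => /andP[].
have Re0 : rsum (fun x => complex.Re (G x)) = 0 by case: G0.
suff : 0 < rsum (fun x => complex.Re (G x)) by rewrite Re0 ltxx.
apply: (rsum_gt0 w _ (6 ^+ m) mu (h%:R * eps) x0 wS (cdominated_Re _ _ dG)).
- by rewrite mulr_ge0.
- apply: (lt_le_trans small); rewrite ler_expR lerN2.
  by rewrite (_ : 2 * pi * _ = 4 * pi * \tr (T j)) ?ler_wpM2l ?mulr_ge0 ?pi_ge0 //; ring.
- move=> x; rewrite GE.
  (* Attaching [mu] to the index [i = j] splits the bound over [i], each index costing one
     [eps * w x]. *)
  have -> : (if x == x0 then mu else 0) - h%:R * eps * w x =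
      \sum_(i < h) ((if (i == j) && (x == x0) then mu else 0) - eps * w x).
    rewrite sumrB sumr_const card_ord -mulrA mulr_natl; congr (_ - _).
    rewrite (bigD1 j) //= eqxx /= big1 ?addr0 // => i /negPf ->.
    by [].
  have -> : complex.Re (\sum_i c i / c j * twisted_average M k (T i) (T j) (val (repr x)))
     = \sum_i complex.Re (c i / c j * twisted_average M k (T i) (T j) (val (repr x))).
    exact: (raddf_sum (@complex.Re R)).
  by apply: ler_sum => i _; exact: term_ge.
Qed.

Theorem corollary5p8 (R : realType) (n : nat) (n_gt0 : (0 < n)%N) :
  exists C : R, forall (N : nat) (k : int) (h : nat) (T : 'I_h -> 'M[R]_n),
    (0 < N)%N ->
    (forall j, Lambda (T j)) ->
    (forall i j, i != j -> ~ GLequiv (T i) (T j)) ->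
    (forall j, automorph_compatible k (T j)) ->
    C * \big[Num.max/0]_(j < h) \tr (T j) <= k%:~R ->
    lin_indep_on (@siegel_half_space R n) (fun j => poincare N k (T j)).
Proof.
pose m := #|{: 'I_n * 'I_(n + n)}|; pose c : R := 2 ^+ n * n.-1`!%:R.
(* The factors come from the number of forms, from [gauss_const] with [kappa = c t^(n-1)], from the
   total coset weight, and from replacing [2^(k - 2 m)] by [2^k]; [r] is the power of [t] released
   by [gauss_const]. *)
pose K := 5 ^+ (n * n) * gauss_const R n c * 6 ^+ m * 2 ^+ (2 * m).
pose r := (n.-1 * (n.-1 * m))%N.
have c0 : 0 <= c by rewrite mulr_ge0 // exprn_ge0.
have g0 : 0 <= gauss_const R n c by exact: gauss_const_ge0.
have K0 : 0 <= K.
  rewrite /K; move: (gauss_const R n c) g0 => g g0.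
  by rewrite !mulr_ge0 ?exprn_ge0.
have [C C0 CK] := poly_exp_lt_exp2 K (n * n + r) K0.
(* The extra [2 m] forces [2 m <= k], since [t >= 1]. *)
exists (C + (2 * m)%:R) => N k h T _ LT neq compat.
set t := \big[_/_]_(j < h) _ => Ck a a0 j.
have Tt i : \tr (T i) <= t by exact: (le_bigmax _ (fun i => \tr (T i)) i).
(* The index [j] shows that the family is nonempty. *)
have t1 : 1 <= t by apply: le_trans (Tt j); exact: Lambda_tr_ge1.
have : 0 <= k%:~R :> R.
  by apply: le_trans Ck; rewrite mulr_ge0 ?addr_ge0 //; lra.
rewrite ler0z; case: k compat Ck a0 => // k compat Ck a0 _.
have m2 : 0 <= (2 * m)%:R :> R by [].
have Ct : C * t <= k%:R by apply: le_trans Ck; rewrite ler_wpM2r ?lerDl //; lra.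
have mk : (2 * m <= k)%N.
  by rewrite -(ler_nat R); apply: le_trans Ck; nra.
have T_inj : injective T.
  move=> i i' Tii; apply/eqP; apply: contraT => /neq[]; exists 1%:M.
    exact: unitmx1.
  by rewrite [intmx _ _]map_mx1 trmx1 mul1mx mulmx1.
have hle := card_Lambda_le _ _ _ _ LT T_inj t1 Tt.
apply: (lin_indep_poincare n N k h T t n_gt0 LT neq compat t1 Tt mk _ a a0 j).
(* Multiplied by [2^k exp(4 pi t)], the smallness condition follows from [poly_exp_lt_exp2] once [h]
   is replaced by its polynomial bound. *)
rewrite [2 ^+ n * (_ * _)]mulrA -/c gauss_constM -/m -/r expRN.
rewrite -[ltRHS]mul1r ltr_pdivlMr ?expR_gt0 //.
have h0 : 0 < 2 ^+ k :> R by rewrite exprn_gt0.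
rewrite -(ltr_pM2r h0) mul1r; apply: le_lt_trans (CK t k t1 Ct).
have -> : 2 ^+ k = 2 ^+ (k - 2 * m) * 2 ^+ (2 * m) :> R by rewrite -exprD subnK.
have p0 : 2 ^+ (k - 2 * m) != 0 :> R by rewrite expf_neq0 // pnatr_eq0.
rewrite [leLHS](_ : _ = h%:R * (gauss_const R n c * t ^+ r * 6 ^+ m * 2 ^+ (2 * m) *
    expR (4 * pi * t))); last by field.
rewrite [leRHS](_ : _ = (5 * t) ^+ (n * n) * (gauss_const R n c * t ^+ r * 6 ^+ m *
    2 ^+ (2 * m) * expR (4 * pi * t))); last by rewrite /K exprMn exprD; ring.
apply: ler_wpM2r hle.
have t0 : 0 <= t by lra.
move: (gauss_const R n c) g0 => g g0.
by rewrite !mulr_ge0 ?expR_ge0 ?exprn_ge0 //.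
Qed.
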